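(* There is a classical algorithm which, given $n$, a graph $G=(V,E)$ with $V=\{1,\dots,n\}$, an $n$-qubit matchgate circuit $U(\boldsymbol{\theta})$ consisting of $O(n)$ blocks (as described in the context) with given real parameter values $\boldsymbol{\theta}$, and an $n$-qubit computational basis state $|a\rangle$, $a\in\{0,1\}^n$, computes the expectation value $$\langle a|\,U(\boldsymbol{\theta})^\dagger\,H_{\mathrm{MaxCut}}\,U(\boldsymbol{\theta})\,|a\rangle,\qquad H_{\mathrm{MaxCut}}=\sum_{(i,j)\in E}Z_iZ_j,$$ using time $O(n^5)$ and memory $O(n^5)$.
   Context: $X_i,Y_i,Z_i$ denote the Pauli operators acting on qubit $i$ of $n$ qubits. The matchgate circuit is a product of $O(n)$ blocks (the number of blocks is at most a fixed constant times $n$). Each block consists of three successive layers of gates. The first layer applies to every qubit $j\in\{1,\dots,n\}$ a gate $\exp(-\tfrac{i}{2}\theta Z_j)$. The second and third layers together apply to each adjacent pair $(j,j+1)$, $j=1,\dots,n-1$, one two-qubit gate $\exp(i\theta\gamma_j)$, where the generator $\gamma_j$ is one of $X_jX_{j+1},\,X_jY_{j+1},\,Y_jX_{j+1},\,Y_jY_{j+1}$ (the choice may differ from block to block and pair to pair but is part of the given circuit). Every gate has its own real parameter $\theta$, so each block has $2n-1$ gates and the whole circuit has $O(n^2)$ gates and parameters. Time is the number of elementary operations, where exact real arithmetic operations and evaluations of $\sin$ and $\cos$ count as unit cost; memory is the number of stored numbers (real numbers or basis indices). *)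

(* Defs.v *)
From HB Require Import structures.
From mathcomp Require Import all_boot all_order all_algebra.
From mathcomp Require Import all_classical all_reals all_analysis.
From mathcomp Require Import complex.

Set Implicit Arguments.
Unset Strict Implicit.
Unset Printing Implicit Defensive.

Import Order.TTheory GRing.Theory Num.Theory.
Import numFieldNormedType.Exports.

Local Open Scope ring_scope.

(** * Operators on [n] qubits

    Qubits and vertices are numbered [0, ..., n-1], i.e. shifted by one from
    the usual {1, ..., n}.  Computational basis states are bit strings
    [{ffun 'I_n -> bool}] ([false] is 0, [true] is 1); an operator is a matrix
    whose rows and columns are indexed by them through [enum_rank]. *)

(* R[i] under its numClosedFieldType structure: this is what lets the topology
   of a numFieldType be inferred on complex numbers and complex matrices. *)
Definition cplx (R : realType) : numClosedFieldType := R[i].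

Definition ofreal (R : realType) (x : R) : cplx R := Complex x 0.

Definition bits (n : nat) := {ffun 'I_n -> bool}.

Notation dim n := #|{: bits n}|.
Notation op R n := 'M[cplx R]_(dim n).

Inductive pauli := PX | PY | PZ.

Definition pauli_entry (R : realType) (s : pauli) (x y : bool) : cplx R :=
  match s with
  | PX => (x != y)%:R
  | PY => if x == y then 0 else if x then 'i else - 'i
  | PZ => if x == y then (-1) ^+ x else 0
  end.

(* 1 (x) ... (x) s (x) ... (x) 1, with s in position q. *)
Definition pauli_at (R : realType) (n : nat) (s : pauli) (q : 'I_n) : op R n :=
  \matrix_(r, c)
    \prod_(k < n)
      (if k == q then pauli_entry R s ((enum_val r : bits n) k)
                                      ((enum_val c : bits n) k)
       else ((enum_val r : bits n) k == (enum_val c : bits n) k)%:R).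

(* The matrix exponential, as the sum of its power series. *)
Definition expmx (R : realType) (d : nat) (A : 'M[cplx R]_d) : 'M[cplx R]_d :=
  lim (series (fun k : nat => (k`!%:R)^-1 *: A ^+ k) @ \oo)%classic.

Definition adjmx (R : realType) (p q : nat) (A : 'M[cplx R]_(p, q)) :
  'M[cplx R]_(q, p) := map_mx Num.conj A^T.

Definition ket (R : realType) (n : nat) (a : bits n) : 'cV[cplx R]_(dim n) :=
  delta_mx (enum_rank a) 0.

(** * Matchgate circuits *)

(* The adjacent pairs (j, j+1) are numbered by their left element [j], in
   ['I_n.-1]. *)
Definition pair_left (n : nat) (j : 'I_n.-1) : 'I_n :=
  widen_ord (leq_pred n) j.

Lemma pair_right_subproof (n : nat) (j : 'I_n.-1) : (j.+1 < n)%N.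
Proof. by case: n j => [|n] [j ltj]. Qed.

Definition pair_right (n : nat) (j : 'I_n.-1) : 'I_n :=
  Ordinal (pair_right_subproof j).

Inductive generator := GXX | GXY | GYX | GYY.

Definition gen_paulis (g : generator) : pauli * pauli :=
  match g with
  | GXX => (PX, PX) | GXY => (PX, PY) | GYX => (PY, PX) | GYY => (PY, PY)
  end.

Definition gen_mx (R : realType) (n : nat) (g : generator) (j : 'I_n.-1) :
    op R n :=
  pauli_at R (gen_paulis g).1 (pair_left j) *
  pauli_at R (gen_paulis g).2 (pair_right j).

(* [blk_third j] tells whether the gate on the pair (j, j+1) sits in the third
   layer rather than in the second one.  The gates of a layer act in parallel
   on disjoint qubits, so overlapping pairs are in different layers. *)
Record block (R : realType) (n : nat) := Block {
  blk_ztheta : 'I_n -> R;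
  blk_gen : 'I_n.-1 -> generator;
  blk_theta : 'I_n.-1 -> R;
  blk_third : 'I_n.-1 -> bool;
  blk_disjoint : forall j k : 'I_n.-1,
    k = j.+1 :> nat -> blk_third k != blk_third j
}.

Definition layer1 (R : realType) (n : nat) (b : block R n) : op R n :=
  \prod_(j < n)
    expmx ((- ('i / 2%:R) * ofreal (blk_ztheta b j)) *: pauli_at R PZ j).

(* The second ([third = false]) or third ([third = true]) layer; its gates
   commute, so that the order of the product is immaterial. *)
Definition layer2 (R : realType) (n : nat) (b : block R n) (third : bool) :
    op R n :=
  \prod_(j < n.-1 | blk_third b j == third)
    expmx (('i * ofreal (blk_theta b j)) *: gen_mx R (blk_gen b j) j).

(* The layer that is applied first is the rightmost factor. *)
Definition block_mx_of (R : realType) (n : nat) (b : block R n) : op R n :=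
  layer2 b true * layer2 b false * layer1 b.

(* The head of the list is the block that is applied first. *)
Fixpoint circuit_mx (R : realType) (n : nat) (bs : seq (block R n)) : op R n :=
  if bs is b :: bs' then circuit_mx bs' * block_mx_of b else 1.

(** * MaxCut *)

(* A graph on ['I_n] is a symmetric irreflexive relation; each edge {i, j}
   contributes one term, the one with i < j. *)
Definition maxcut_ham (R : realType) (n : nat) (E : rel 'I_n) : op R n :=
  \sum_(i < n) \sum_(j < n | (i < j)%N && E i j)
    pauli_at R PZ i * pauli_at R PZ j.

Definition expval (R : realType) (n : nat) (H U : op R n) (a : bits n) :
    cplx R :=
  (adjmx (ket R a) *m adjmx U *m H *m U *m ket R a) 0 0.

(** * Programs over the reals

    A random access machine with two kinds of cells, holding natural numbers
    (indices) or real numbers.  Cells are grouped into arrays; a program names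
    the arrays it uses by numerals, so it uses finitely many of them, and it
    addresses the cells of an array by computed indices.  The only operations
    on reals are the field operations, [sin], [cos], comparison, and the
    conversion of an index; in particular there is no rounding and no conversion
    from reals to indices.  The syntax does not mention the real numbers, so
    the only constants of a program are natural numbers. *)

Inductive iexp :=
| IConst of nat
| ILoad of nat & iexp         (* [ILoad x e]: cell number e of array x *)
| IAdd of iexp & iexp
| ISub of iexp & iexp         (* truncated *)
| IMul of iexp & iexp.

Inductive rexp :=
| ROfIndex of iexp
| RLoad of nat & iexp
| ROpp of rexp
| RAdd of rexp & rexp
| RSub of rexp & rexp
| RMul of rexp & rexp
| RDiv of rexp & rexp         (* x / 0 = 0 *)
| RSin of rexp
| RCos of rexp.

Inductive bexp :=
| BIle of iexp & iexp
| BIeq of iexp & iexp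
| BRle of rexp & rexp
| BNot of bexp
| BAnd of bexp & bexp.

Inductive cmd :=
| Skip
| IStore of nat & iexp & iexp (* [IStore x e v]: cell e of array x := v *)
| RStore of nat & iexp & rexp
| Seq of cmd & cmd
| If of bexp & cmd & cmd
| While of bexp & cmd.

(* An array is the list of its cells from the cell 0 on. *)
Record state (R : realType) := State {
  imem : seq (seq nat);
  rmem : seq (seq R)
}.

(* Cells that were never written read as the default value. *)
Definition load (T : Type) (d : T) (m : seq (seq T)) (x i : nat) : T :=
  nth d (nth [::] m x) i.

(* Storing past the end of an array allocates all the cells in between. *)
Definition store (T : Type) (d : T) (m : seq (seq T)) (x i : nat) (v : T) :
    seq (seq T) :=
  set_nth [::] m x (set_nth d (nth [::] m x) i v).

(* The number of stored numbers, input included.  It never decreases along an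
   execution (lemma [exec_memory] below), so its final value is its peak. *)
Definition memory (R : realType) (st : state R) : nat :=
  (size (flatten (imem st)) + size (flatten (rmem st)))%N.

Fixpoint ieval (R : realType) (st : state R) (e : iexp) : nat :=
  match e with
  | IConst k => k
  | ILoad x e => load 0%N (imem st) x (ieval st e)
  | IAdd e f => (ieval st e + ieval st f)%N
  | ISub e f => (ieval st e - ieval st f)%N
  | IMul e f => (ieval st e * ieval st f)%N
  end.

Fixpoint reval (R : realType) (st : state R) (e : rexp) : R :=
  match e with
  | ROfIndex e => (ieval st e)%:R
  | RLoad x e => load 0 (rmem st) x (ieval st e)
  | ROpp e => - reval st e
  | RAdd e f => reval st e + reval st f
  | RSub e f => reval st e - reval st f
  | RMul e f => reval st e * reval st f
  | RDiv e f => reval st e / reval st f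
  | RSin e => sin (reval st e)
  | RCos e => cos (reval st e)
  end.

Fixpoint beval (R : realType) (st : state R) (b : bexp) : bool :=
  match b with
  | BIle e f => (ieval st e <= ieval st f)%N
  | BIeq e f => ieval st e == ieval st f
  | BRle e f => reval st e <= reval st f
  | BNot b => ~~ beval st b
  | BAnd b c => beval st b && beval st c
  end.

(* Every constant, memory access, arithmetic operation, evaluation of sin or
   cos, comparison and connective is one elementary operation. *)
Fixpoint icost (e : iexp) : nat :=
  match e with
  | IConst _ => 1
  | ILoad _ e => (icost e).+1
  | IAdd e f | ISub e f | IMul e f => (icost e + icost f).+1
  end.

Fixpoint rcost (e : rexp) : nat :=
  match e with
  | ROfIndex e | RLoad _ e => (icost e).+1
  | ROpp e | RSin e | RCos e => (rcost e).+1
  | RAdd e f | RSub e f | RMul e f | RDiv e f => (rcost e + rcost f).+1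
  end.

Fixpoint bcost (b : bexp) : nat :=
  match b with
  | BIle e f | BIeq e f => (icost e + icost f).+1
  | BRle e f => (rcost e + rcost f).+1
  | BNot b => (bcost b).+1
  | BAnd b c => (bcost b + bcost c).+1
  end.

(* [exec w c st t st']: started in [st], the program [c] halts in [st'] after
   [t] elementary operations.  Index cells only hold numbers below [w]: with
   [w] polynomial in the input size they have logarithmically many bits, and
   cannot be used to pack many numbers into one. *)
Inductive exec (R : realType) (w : nat) :
    cmd -> state R -> nat -> state R -> Prop :=
| ExecSkip st : exec w Skip st 1 st
| ExecIStore x e v st :
    (ieval st v < w)%N ->
    exec w (IStore x e v) st (icost e + icost v).+1
      (State (store 0%N (imem st) x (ieval st e) (ieval st v)) (rmem st))
| ExecRStore x e v st :
    exec w (RStore x e v) st (icost e + rcost v).+1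
      (State (imem st) (store 0 (rmem st) x (ieval st e) (reval st v)))
| ExecSeq c d st t st' t' st'' :
    exec w c st t st' -> exec w d st' t' st'' ->
    exec w (Seq c d) st (t + t') st''
| ExecIfTrue b c d st t st' :
    beval st b -> exec w c st t st' ->
    exec w (If b c d) st (bcost b + t).+1 st'
| ExecIfFalse b c d st t st' :
    ~~ beval st b -> exec w d st t st' ->
    exec w (If b c d) st (bcost b + t).+1 st'
| ExecWhileTrue b c st t st' t' st'' :
    beval st b -> exec w c st t st' -> exec w (While b c) st' t' st'' ->
    exec w (While b c) st (bcost b + t + t').+1 st''
| ExecWhileFalse b c st :
    ~~ beval st b -> exec w (While b c) st (bcost b).+1 st.

Lemma size_flatten_set_nth (T : Type) (m : seq (seq T)) (x : nat) (s : seq T) :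
  (size (nth [::] m x) <= size s)%N ->
  (size (flatten m) <= size (flatten (set_nth [::] m x s)))%N.
Proof.
elim: m x => [|r m IHm] [|x] //=.
  by move=> les; rewrite !size_cat leq_add2r.
by move=> les; rewrite !size_cat leq_add2l IHm.
Qed.

Lemma size_flatten_store (T : Type) (d : T) m x i v :
  (size (flatten m) <= size (flatten (store d m x i v)))%N.
Proof. by apply: size_flatten_set_nth; rewrite size_set_nth leq_maxr. Qed.

Lemma exec_memory (R : realType) w c (st : state R) t st' :
  exec w c st t st' -> (memory st <= memory st')%N.
Proof.
elim=> {c st t st'} //.
- by move=> *; rewrite leq_add2r size_flatten_store.
- by move=> *; rewrite leq_add2l size_flatten_store.
- by move=> c d st t st' t' st'' _ le1 _; apply: leq_trans.
- by move=> b c st t st' t' st'' _ _ le1 _; apply: leq_trans.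
Qed.

(** * Input and output *)

Definition gen_code (g : generator) : nat :=
  match g with GXX => 0 | GXY => 1 | GYX => 2 | GYY => 3 end.

(* Index arrays: 0 holds n and the number of blocks, 1 the adjacency matrix
   of the graph, 2 the generators, 3 the layers of the two-qubit gates, 4 the
   basis state.  Real arrays: 0 holds the parameters of the one-qubit gates,
   1 those of the two-qubit gates.  Doubly indexed data are in row-major
   order. *)
Definition input (R : realType) (n : nat) (E : rel 'I_n) (bs : seq (block R n))
    (a : bits n) : state R :=
  State
    [:: [:: n; size bs];
        [seq nat_of_bool (E i j) | i <- enum 'I_n, j <- enum 'I_n];
        [seq gen_code (blk_gen b j) | b <- bs, j <- enum 'I_n.-1];
        [seq nat_of_bool (blk_third b j) | b <- bs, j <- enum 'I_n.-1];
        [seq nat_of_bool (a i) | i <- enum 'I_n]]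
    [:: [seq blk_ztheta b j | b <- bs, j <- enum 'I_n];
        [seq blk_theta b j | b <- bs, j <- enum 'I_n.-1]].

(* The result is left in cell 0 of the real array 2. *)
Definition output (R : realType) (st : state R) : R := load 0 (rmem st) 2 0.

(* Main.v *)
(* The Jordan-Wigner strings c_0, ..., c_{2n-1} (Majorana operators) turn a
   matchgate circuit into free fermions: every generator is +-i c_p c_q, so that
   conjugation by a gate rotates the plane spanned by c_p and c_q and fixes the
   other c_m.  For a basis state, and hence for all states reached by the circuit,
   the expectation of a product of Majorana operators is given by Wick's formula
   from the real antisymmetric matrix M with <c_y c_z> = i M_yz (y <> z); as
   Z_i Z_j = - c_{2i} c_{2i+1} c_{2j} c_{2j+1}, the expectation of H_MaxCut is a
   sum of 4x4 Pfaffians of M.  The algorithm stores M and updates it by one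
   Givens rotation per gate, at cost O(n), hence O(n^3) in total. *)

Require Import Defs.
From mathcomp Require Import all_boot all_order all_algebra.
From mathcomp Require Import all_classical all_reals all_analysis.
From mathcomp Require Import complex ring zify.

Set Implicit Arguments.
Unset Strict Implicit.
Unset Printing Implicit Defensive.

Import Order.TTheory GRing.Theory Num.Theory.
Import numFieldNormedType.Exports.

Local Open Scope ring_scope.

(** * Complex numbers and exponentials of involutions *)

(** The state vector has exponentially many entries and never occurs in the program, so the proof
    needs a property of states that survives every gate and still determines the quartic
    expectations [Z_i Z_j]. Wick's formula itself is awkward to transport through a gate. The
    predicate [gaussian] asks instead for operators [B_s] that replace the Majorana operators on the
    state; a gate carries them along by conjugation, and two- and four-point functions follow by
    moving [B_s] to the bra. Generators couple neighbouring qubits only: the [Z] strings of the two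
    Majorana operators cancel up to the left qubit, which is why each generator is quadratic in
    them. A generator squares to 1, so its exponential is a combination of 1 and [c_p c_q], and
    conjugation by it rotates by twice the angle in the exponent. Time is separated from
    correctness. Once every loop is known to make at most [L] rounds, the cost is a polynomial in
    [L] whose degree is the nesting depth of the program text. *)

Lemma ofrealD (R : realType) (x y : R) : ofreal (x + y) = ofreal x + ofreal y.
Proof. by rewrite /ofreal; apply/eqP; rewrite eq_complex /= addr0 !eqxx. Qed.

Lemma ofrealM (R : realType) (x y : R) : ofreal (x * y) = ofreal x * ofreal y.
Proof.
by apply/eqP; rewrite eq_complex /= !mulr0 !mul0r subr0 addr0 !eqxx.
Qed.

Lemma ofrealN (R : realType) (x : R) : ofreal (- x) = - ofreal x.
Proof. by apply/eqP; rewrite eq_complex /= oppr0 !eqxx. Qed.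

Lemma ofreal0 (R : realType) : ofreal (0 : R) = 0.
Proof. by []. Qed.

Lemma ofreal1 (R : realType) : ofreal (1 : R) = 1.
Proof. by []. Qed.

Lemma ofrealX (R : realType) (x : R) k : ofreal (x ^+ k) = ofreal x ^+ k.
Proof. by elim: k => // k IHk; rewrite !exprS ofrealM IHk. Qed.

Lemma ofreal_nat (R : realType) k : ofreal (k%:R : R) = k%:R.
Proof. by elim: k => // k IHk; rewrite -[k.+1]addn1 !natrD ofrealD IHk. Qed.

Lemma ofrealV (R : realType) (x : R) : ofreal x^-1 = (ofreal x)^-1.
Proof.
have [->|x0] := eqVneq x 0; first by rewrite !(invr0, ofreal0).
have x0' : ofreal x != 0 by rewrite eq_complex /= (negPf x0).
by apply: (mulfI x0'); rewrite -ofrealM !mulfV // ofreal1.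
Qed.

Lemma ofreal_conj (R : realType) (x : R) : (ofreal x)^* = ofreal x.
Proof. by apply/eqP; rewrite eq_complex /= oppr0 !eqxx. Qed.

Lemma ofreal_sum (R : realType) I (s : seq I) P (F : I -> R) :
  ofreal (\sum_(i <- s | P i) F i) = \sum_(i <- s | P i) ofreal (F i).
Proof. by elim/big_rec2: _ => // i x y _ <-; rewrite ofrealD. Qed.

Lemma ofreal_norm (R : realType) (x : R) : `|ofreal x| = ofreal `|x|.
Proof. by rewrite /ofreal normc_def /= expr0n addr0 sqrtr_sqr. Qed.

Lemma cvg_ofreal (R : realType) (u : nat -> R) (l : R) :
  (u @ \oo --> l)%classic ->
  ((fun k => ofreal (u k)) @ \oo --> (ofreal l : cplx R))%classic.
Proof.
move=> ul; apply/cvgrPdist_lt => e e0.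
(* In the order on complex numbers [0 < e] forces [e] to be real, so a real tolerance is enough. *)
have [re ee] : 0 < complex.Re e /\ e = ofreal (complex.Re e).
  case: e e0 => er ei; rewrite ltcE /= => /andP[/eqP ei0 er0].
  by split=> //; rewrite /ofreal ei0.
move/cvgrPdist_lt: ul => /(_ _ re); apply: filterS => k.
rewrite -ofrealN -ofrealD ofreal_norm {2}ee.
by rewrite /ofreal ltcR.
Qed.

Lemma expmxZ (F : comPzRingType) d (x : F) (A : 'M[F]_d) k :
  (x *: A) ^+ k = x ^+ k *: A ^+ k.
Proof.
elim: k => [|k IHk]; first by rewrite !expr0 scale1r.
rewrite !exprS IHk -[LHS]/((x *: A) *m (x ^+ k *: A ^+ k)).
by rewrite -scalemxAl -scalemxAr scalerA.
Qed.

(* A square root of 1 splits the exponential series into the series of cos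
   (even powers) and sin (odd powers). *)
Lemma expmx_involution (R : realType) d (A : 'M[cplx R]_d) (x : R) :
  A * A = 1 ->
  expmx (('i * ofreal x) *: A) =
    (ofreal (cos x))%:M + ('i * ofreal (sin x)) *: A.
Proof.
move=> A2; rewrite -scalemx1 /expmx.
set u := (X in series X).
have uE k : u k = ofreal (cos_coeff x k) *: (1 : 'M[cplx R]_d) +
    ('i * ofreal (sin_coeff x k)) *: A.
  rewrite /u expmxZ scalerA.
  have AE m : A ^+ m = if odd m then A else 1.
    elim: m => // m IHm; rewrite exprS IHm /=.
    by case: (odd m); rewrite //= mulr1.
  have iE m : ('i : cplx R) ^+ m = (if odd m then 'i else 1) * (-1) ^+ m./2.
    rewrite -{1}(odd_double_half m) -mul2n exprD exprM sqrCi.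
    by case: (odd m); rewrite ?expr1 ?expr0.
  rewrite AE /cos_coeff /sin_coeff /= !ofrealM !ofrealV !ofrealX !ofrealN
    ofreal1 !ofreal_nat exprMn iE.
  case: ifP => odk /=.
    rewrite !mul0r scale0r add0r mul1r; congr (_ *: _).
    (* Splitting the power of i gives the exponent [k./2], whereas [sin_coeff] has [k.-1./2]; they
       agree for odd [k]. *)
    have -> : k./2 = k.-1./2 by move: odk; lia.
    by ring.
  rewrite mul0r mul0r mul0r mulr0 scale0r addr0; congr (_ *: _).
  by rewrite !mul1r mulrC.
have su k : series u k = ofreal (series (cos_coeff x) k) *: (1 : 'M[cplx R]_d) +
    ('i * ofreal (series (sin_coeff x) k)) *: A.
  rewrite /series /= !ofreal_sum mulr_sumr !scaler_suml -big_split /=.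
  by apply: eq_bigr => i _; rewrite uE.
apply: cvg_lim; first exact: norm_hausdorff.
rewrite (_ : series u = fun k => ofreal (series (cos_coeff x) k) *: (1 : 'M[cplx R]_d) +
    ('i * ofreal (series (sin_coeff x) k)) *: A); last exact/funext.
apply: cvgD; apply: cvgZl.
  by apply: cvg_ofreal; rewrite unlock; exact: is_cvg_series_cos_coeff.
apply: cvgM; first exact: cvg_cst.
by apply: cvg_ofreal; rewrite unlock; exact: is_cvg_series_sin_coeff.
Qed.

(** * Pauli strings and Majorana operators *)

Local Notation dim n := #|{: bits n}|.
Local Notation op R n := 'M[cplx R]_(dim n).

(** [None] is the identity; with it the one-qubit labels are closed under products up to a phase. *)
Definition pauli1 (R : realType) (s : option pauli) (x y : bool) : cplx R :=
  if s is Some p then pauli_entry R p x y else (x == y)%:R.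

Definition pauli_mul (s t : option pauli) : option pauli :=
  match s, t with
  | None, p | p, None => p
  | Some PX, Some PX | Some PY, Some PY | Some PZ, Some PZ => None
  | Some PX, Some PY | Some PY, Some PX => Some PZ
  | Some PX, Some PZ | Some PZ, Some PX => Some PY
  | Some PY, Some PZ | Some PZ, Some PY => Some PX
  end.

Definition pauli_phase (R : realType) (s t : option pauli) : cplx R :=
  match s, t with
  | Some PX, Some PY | Some PY, Some PZ | Some PZ, Some PX => 'i
  | Some PY, Some PX | Some PZ, Some PY | Some PX, Some PZ => - 'i
  | _, _ => 1
  end.

Lemma pauli1_mul (R : realType) s t x y :
  \sum_(z : bool) pauli1 R s x z * pauli1 R t z y =
    pauli_phase R s t * pauli1 R (pauli_mul s t) x y.
Proof.
have ii : 'i * 'i = -1 :> cplx R by rewrite -expr2 sqrCi.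
rewrite big_bool /=.
case: s => [[]|]; case: t => [[]|]; case: x; case: y => //=;
  rewrite ?(mulr0, mul0r, addr0, add0r, mulr1, mul1r, expr1, expr0,
            mulrN, mulNr, ii, opprK) //=.
Qed.

(** The tensor product of the one-qubit operators [s k], written entrywise. *)
Definition pstring (R : realType) n (s : 'I_n -> option pauli) : op R n :=
  \matrix_(r, c) \prod_(k < n)
    pauli1 R (s k) ((enum_val r : bits n) k) ((enum_val c : bits n) k).

Lemma eq_pstring (R : realType) n (s t : 'I_n -> option pauli) :
  s =1 t -> pstring R s = pstring R t.
Proof.
by move=> st; apply/matrixP => r c; rewrite !mxE; apply: eq_bigr => k _; rewrite st.
Qed.

(** The matrix product sums over all bit strings a product over qubits; distributivity turns this
    into a product over qubits of one-qubit matrix products. *)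
Lemma pstring_mul (R : realType) n (s t : 'I_n -> option pauli) :
  pstring R s * pstring R t =
    (\prod_(k < n) pauli_phase R (s k) (t k)) *:
      pstring R (fun k => pauli_mul (s k) (t k)).
Proof.
apply/matrixP => r c; rewrite !mxE -big_split /=.
transitivity (\sum_(f : bits n) \prod_(k < n)
   (pauli1 R (s k) ((enum_val r : bits n) k) (f k) *
    pauli1 R (t k) (f k) ((enum_val c : bits n) k))).
  rewrite [RHS](reindex (fun i : 'I_(#|{: bits n}|) => enum_val i)) /=; last first.
    exact/onW_bij/enum_val_bij.
  apply: eq_bigr => i _.
  by rewrite !mxE -big_split.
rewrite -(bigA_distr_bigA (fun k z => pauli1 R (s k) ((enum_val r : bits n) k) z *
    pauli1 R (t k) z ((enum_val c : bits n) k))).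
by apply: eq_bigr => k _; rewrite pauli1_mul.
Qed.

Lemma pstring_id (R : realType) n : pstring R (fun _ : 'I_n => None) = 1.
Proof.
apply/matrixP => r c; rewrite !mxE /=.
have [->|rc] := eqVneq r c; first by rewrite big1 // => k _; rewrite eqxx.
suff [k /negPf rck] : exists k, (enum_val r : bits n) k != (enum_val c : bits n) k.
  by rewrite (bigD1 k) //= rck mul0r.
apply/existsP; apply: contraNT rc; rewrite negb_exists => /forallP rc.
apply/eqP/enum_val_inj/ffunP => k; apply/eqP.
by have := rc k; rewrite negbK.
Qed.

Lemma pauli1_conj (R : realType) s x y : (pauli1 R s x y)^* = pauli1 R s y x.
Proof.
have b_conj (b : bool) : (b%:R : cplx R)^* = b%:R by rewrite rmorph_nat.
case: s => [[]|]; rewrite /pauli1 /pauli_entry; first by rewrite b_conj eq_sym.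
- rewrite eq_sym; case: eqVneq => [_|]; first exact: (b_conj false).
  case: x; case: y => //= _; first exact: conjCi.
  by apply: (canLR (@conjCK _)); rewrite conjCi.
- rewrite eq_sym; case: eqVneq => [->|_]; last exact: (b_conj false).
  by rewrite rmorphXn rmorphN rmorph1.
- by rewrite b_conj eq_sym.
Qed.

Lemma pstring_adj (R : realType) n (s : 'I_n -> option pauli) :
  adjmx (pstring R s) = pstring R s.
Proof.
apply/matrixP => r c; rewrite !mxE rmorph_prod; apply: eq_bigr => k _.
exact: pauli1_conj.
Qed.

Lemma pauli_atE (R : realType) n p (q : 'I_n) :
  pauli_at R p q = pstring R (fun k => if k == q then Some p else None).
Proof.
by apply/matrixP => r c; rewrite !mxE; apply: eq_bigr => k _; case: (k == q).
Qed.

(* The Jordan-Wigner strings c_{2j} = Z...Z X_j and c_{2j+1} = Z...Z Y_j. *)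
Definition majorana_string (m k : nat) : option pauli :=
  if (k < m./2)%N then Some PZ
  else if k == m./2 then Some (if odd m then PY else PX) else None.

Definition majorana (R : realType) n (m : nat) : op R n :=
  pstring R (fun k : 'I_n => majorana_string m k).

Lemma majorana_adj (R : realType) n m : adjmx (majorana R n m) = majorana R n m.
Proof. exact: pstring_adj. Qed.

Lemma majorana_sqr (R : realType) n m : majorana R n m * majorana R n m = 1.
Proof.
rewrite /majorana pstring_mul big1; last first.
  by move=> k _; case: majorana_string => [[]|].
rewrite scale1r -pstring_id; apply: eq_pstring => k.
by case: majorana_string => [[]|].
Qed.

(** Both orders give the same string, and their phases agree at every qubit except the smaller of
    [m./2] and [l./2]. There two distinct Paulis meet: X or Y against Z, or X against Y when the two
    qubits coincide. *)
Lemma majorana_anticomm (R : realType) n m l :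
  (m < 2 * n)%N -> (l < 2 * n)%N -> m != l ->
  majorana R n m * majorana R n l = - (majorana R n l * majorana R n m).
Proof.
move=> mn ln ml; rewrite /majorana !pstring_mul.
have [j jE] : exists j : 'I_n, j = minn m./2 l./2 :> nat.
  have jn : (minn m./2 l./2 < n)%N by lia.
  by exists (Ordinal jn).
rewrite -scaleNr; congr (_ *: _); last first.
  apply: eq_pstring => k.
  by case: (majorana_string m k) => [[]|]; case: (majorana_string l k) => [[]|].
rewrite (bigD1 j) // [in RHS](bigD1 j) //= -mulNr; congr (_ * _).
  rewrite /majorana_string.
  have [lt|gt|eq] := ltngtP m./2 l./2.
  - have -> : j = m./2 :> nat by lia.
    by rewrite ltnn eqxx lt; case: odd; rewrite /= ?opprK.
  - have -> : j = l./2 :> nat by lia.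
    by rewrite ltnn eqxx gt; case: odd; rewrite /= ?opprK.
  - have -> : j = l./2 :> nat by lia.
    rewrite eq ltnn eqxx; have : odd m != odd l by lia.
    by case: odd; case: odd => //= _; rewrite opprK.
apply: eq_bigr => k kj.
have {}kj : k != minn m./2 l./2 :> nat by rewrite -jE.
rewrite /majorana_string.
have [km|mk|mk] := ltngtP k m./2; have [kl|lk|lk] := ltngtP k l./2 => //=;
  by [case: odd | exfalso; lia].
Qed.

(** * Gaussian states *)

(** Stated for an arbitrary module because the same plane rotation acts on operators, on vectors
    such as [c_m psi], and on scalars. *)
Definition rotate (K : pzRingType) (V : lmodType K) (p q : nat) (c s : K)
    (f : nat -> V) (y : nat) : V :=
  if y == p then c *: f p - s *: f q
  else if y == q then s *: f p + c *: f q else f y.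

Lemma rotate_linear (K : pzRingType) (V W : lmodType K) (h : {linear V -> W})
    p q c s (f : nat -> V) y :
  h (rotate p q c s f y) = rotate p q c s (fun t => h (f t)) y.
Proof.
rewrite /rotate; case: ifP => _; first by rewrite linearB !linearZ.
by case: ifP => _ //; rewrite linearD !linearZ.
Qed.

Lemma eq_rotate (K : pzRingType) (V : lmodType K) N p q c s (f g : nat -> V) :
  (p < N)%N -> (q < N)%N -> (forall t, (t < N)%N -> f t = g t) ->
  forall y, (y < N)%N -> rotate p q c s f y = rotate p q c s g y.
Proof. by move=> pN qN fg y yN; rewrite /rotate !fg. Qed.

(** The congruence [G M G^T] by the Givens rotation [G] of the plane [(p, q)]. *)
Definition rotate2 (R : realType) (p q : nat) (c s : R) (M : nat -> nat -> R)
    (y z : nat) : R :=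
  rotate p q c s (fun y' => rotate p q c s (M y' : nat -> R^o) z : R^o) y.

(* The covariance matrix of the state transforms like the Majorana operators. *)
Lemma rotate_covariance (R : realType) p q (c s : R) (M : nat -> nat -> R) y z :
  p != q -> c ^+ 2 + s ^+ 2 = 1 ->
  rotate p q (ofreal c) (ofreal s) (fun y' => rotate p q (ofreal c) (ofreal s)
    (fun z' => (y' == z')%:R + 'i * ofreal (M y' z') : (cplx R)^o) z : (cplx R)^o) y
  = (y == z)%:R + 'i * ofreal (rotate2 p q c s M y z).
Proof.
move=> pq cs1.
(* Orthogonality of the rotation, as a rewriting rule for [ring]; it is what preserves the Kronecker
   delta. *)
have {cs1} H : ofreal c ^+ 2 = 1 - ofreal s ^+ 2.
  by rewrite -[1]/(ofreal 1) -cs1 ofrealD !ofrealX addrK.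
have qp : (q == p) = false by rewrite eq_sym (negPf pq).
rewrite /rotate2 /rotate /GRing.scale /=.
case: (eqVneq y p) => [yp|yp]; [|case: (eqVneq y q) => [yq|yq]];
 (case: (eqVneq z p) => [zp|zp]; [|case: (eqVneq z q) => [zq|zq]]);
  rewrite ?yp ?yq ?zp ?zq ?(eq_sym p z) ?(eq_sym q z) ?eqxx ?qp ?(negPf pq)
    ?(negPf yp) ?(negPf yq) ?(negPf zp) ?(negPf zq)
    ?(ofrealD, ofrealN, ofrealM) //=; ring: H.
Qed.

Lemma adjmxM (R : realType) m n p (A : 'M[cplx R]_(m, n)) (B : 'M[cplx R]_(n, p)) :
  adjmx (A *m B) = adjmx B *m adjmx A.
Proof. by rewrite /adjmx trmx_mul map_mxM. Qed.

Lemma adjmxD (R : realType) m n (A B : 'M[cplx R]_(m, n)) :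
  adjmx (A + B) = adjmx A + adjmx B.
Proof. by apply/matrixP => i j; rewrite !mxE rmorphD. Qed.

Lemma adjmxZ (R : realType) m n a (A : 'M[cplx R]_(m, n)) :
  adjmx (a *: A) = a^* *: adjmx A.
Proof. by apply/matrixP => i j; rewrite !mxE rmorphM. Qed.

Lemma adjmx_scalar (R : realType) n a : adjmx (a%:M : 'M[cplx R]_n) = (a^*)%:M.
Proof. by apply/matrixP => i j; rewrite !mxE eq_sym rmorphMn. Qed.

Lemma mulmx_scalar_conj (F : comPzRingType) d (x y : F) (W A : 'M[F]_d) :
  (x%:M + y *: W) *m A *m (x%:M - y *: W) =
  x ^+ 2 *: A + (x * y) *: (W *m A - A *m W) - y ^+ 2 *: (W *m A *m W).
Proof.
have -> : (x%:M + y *: W) *m A = x *: A + y *: (W *m A).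
  by rewrite mulmxDl mul_scalar_mx scalemxAl.
have yW (B : 'M[F]_d) : B *m (x%:M - y *: W) = x *: B - y *: (B *m W).
  by rewrite mulmxBr mul_mx_scalar scalemxAr.
rewrite yW mulmxDl -!scalemxAl; apply/matrixP => i j; rewrite !mxE; ring.
Qed.

(** Shifts the conjugation from [X], later the operator [B_s], onto [A], later a Majorana operator,
    whose conjugate is known explicitly. *)
Lemma conj_anticomm (K : pzRingType) (U V A X : K) : U * V = 1 ->
  U * (V * A * U * X + X * (V * A * U)) * V = A * (U * X * V) + U * X * V * A.
Proof.
move=> UV; rewrite mulrDr mulrDl !mulrA UV mul1r.
by rewrite -[U * X * V * A * U * V]mulrA UV mulr1.
Qed.

(* Each Majorana operator c_s agrees on psi with an operator B_s which is
   annihilated by psi from the left and whose anticommutators with the Majorana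
   operators are scalars: this is what the proof of Wick's formula needs. *)
Definition gaussian (R : realType) n (psi : 'cV[cplx R]_(dim n))
    (M : nat -> nat -> R) : Prop :=
  adjmx psi *m psi = 1%:M /\
  exists B : nat -> op R n, forall s, (s < 2 * n)%N ->
    [/\ majorana R n s *m psi = B s *m psi, adjmx psi *m B s = 0
      & forall m, (m < 2 * n)%N ->
        majorana R n m * B s + B s * majorana R n m =
          ((m == s)%:R + 'i * ofreal (M m s))%:M].

(** * Conjugation by the exponential of a product of two Majorana operators *)

Section Rotation.
Variables (R : realType) (n p q : nat) (x y : R).
Hypotheses (pn : (p < 2 * n)%N) (qn : (q < 2 * n)%N) (pq : p != q).

Let c := majorana R n.
Let W := c p * c q.
Let X : cplx R := ofreal x.
Let Y : cplx R := ofreal y.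
Let U : op R n := X%:M - Y *: W.
Let V : op R n := X%:M + Y *: W.

Let cpq : c q * c p = - W.
Proof. by rewrite /W [in RHS]majorana_anticomm // opprK. Qed.

Let Wp : W * c p = - c q.
Proof. by rewrite /W -mulrA cpq /W mulrN mulrA majorana_sqr mul1r. Qed.

Let Wq : W * c q = c p.
Proof. by rewrite /W -mulrA majorana_sqr mulr1. Qed.

Let pW : c p * W = c q.
Proof. by rewrite /W mulrA majorana_sqr mul1r. Qed.

Let qW : c q * W = - c p.
Proof. by rewrite /W mulrA cpq mulNr Wq. Qed.

Lemma majorana_pair_sqr : W * W = -1.
Proof. by rewrite {2}/W mulrA Wp mulNr majorana_sqr. Qed.

Hypothesis xy1 : x ^+ 2 + y ^+ 2 = 1.

Let VAU (A : op R n) : V * A * U =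
  X ^+ 2 *: A + (X * Y) *: (W * A - A * W) - Y ^+ 2 *: (W * A * W).
Proof. exact: mulmx_scalar_conj. Qed.

Let VU : V * U = 1.
Proof.
rewrite -[V]mulr1 VAU mulr1 mul1r subrr scaler0 addr0 majorana_pair_sqr.
by rewrite scalerN opprK -scalerDl -!ofrealX -ofrealD xy1 scale1r.
Qed.

Let UV : U * V = 1. Proof. exact: mulmx1C VU. Qed.

Let adjU : adjmx U = V.
Proof.
rewrite /U /V -scaleNr adjmxD adjmxZ adjmx_scalar ofreal_conj.
rewrite -[X in adjmx X]/(majorana R n p *m majorana R n q) adjmxM !majorana_adj.
rewrite -[_ *m _]/(c q * c p) cpq -ofrealN ofreal_conj ofrealN.
by rewrite scaleNr scalerN opprK.
Qed.

Let commW t : (t < 2 * n)%N -> t != p -> t != q -> c t * W = W * c t.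
Proof.
move=> tn tp tq; rewrite /W mulrA (majorana_anticomm R tn pn tp) mulNr -!mulrA.
by rewrite (majorana_anticomm R tn qn tq) mulrN opprK.
Qed.

(** [W] squares to -1 and anticommutes with [c p] and [c q], so there [V * c t * U] equals
    [V * V * c t], and squaring [V] doubles the angle. All other [c t] commute with [W] and are
    fixed because [V * U = 1]. *)
Lemma rotation_conj t : (t < 2 * n)%N ->
  V * c t * U = rotate p q (ofreal (x ^+ 2 - y ^+ 2)) (ofreal (x * y *+ 2)) c t.
Proof.
move=> tn.
rewrite VAU /X /Y ofrealD ofrealN mulr2n ofrealD !(ofrealX, ofrealM).
rewrite /rotate; case: eqVneq => [->|tp]; last case: eqVneq => [->|tq].
- rewrite Wp mulNr pW qW; move: (c p) (c q) => P Q.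
  by apply/matrixP => i j; rewrite !mxE; ring.
- rewrite Wq pW qW; move: (c p) (c q) => P Q.
  by apply/matrixP => i j; rewrite !mxE; ring.
- rewrite commW // subrr scaler0 addr0 -commW // -mulrA majorana_pair_sqr mulrN mulr1.
  by rewrite scalerN opprK -scalerDl -!ofrealX -ofrealD xy1 scale1r.
Qed.

Let rot (W : lmodType (cplx R)) :=
  @rotate _ W p q (ofreal (x ^+ 2 - y ^+ 2)) (ofreal (x * y *+ 2)).

Let acomm_rotl (f : nat -> op R n) (A : op R n) m :
  rot f m * A + A * rot f m = rot (fun t => f t * A + A * f t) m.
Proof.
exact: (@rotate_linear _ _ _
  (mulmxr A \+ mulmx A : {linear op R n -> op R n}) p q _ _ f m).
Qed.

Let acomm_rotr (f : nat -> op R n) (A : op R n) m :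
  A * rot f m + rot f m * A = rot (fun t => A * f t + f t * A) m.
Proof.
exact: (@rotate_linear _ _ _
  (mulmx A \+ mulmxr A : {linear op R n -> op R n}) p q _ _ f m).
Qed.

Let rot_scalar (k : nat -> cplx R) m :
  rot (fun t => (k t)%:M : op R n) m = (rot (k : nat -> (cplx R)^o) m)%:M.
Proof.
rewrite /rot /rotate; case: (m == p); [|case: (m == q)].
- apply/matrixP => i j.
  rewrite !mxE.
  by case: (i == j); rewrite ?mulr1n ?mulr0n ?mulr0 ?subrr.
- apply/matrixP => i j; rewrite !mxE.
  by case: (i == j); rewrite ?mulr1n ?mulr0n ?mulr0 ?addr0.
- by [].
Qed.

Lemma gaussian_rotation psi M :
  gaussian psi M ->
  gaussian (U *m psi) (rotate2 p q (x ^+ 2 - y ^+ 2) (x * y *+ 2) M).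
Proof.
move=> [psi1 [B hB]].
have opM (A D : op R n) (v : 'cV[cplx R]_(dim n)) : (A * D) *m v = A *m (D *m v).
  by rewrite mulmxA.
have ab1 : (x ^+ 2 - y ^+ 2) ^+ 2 + (x * y *+ 2) ^+ 2 = 1.
  rewrite -[1](expr1n _ 2) -xy1; ring.
split.
  by rewrite adjmxM adjU -mulmxA -opM VU mul1mx.
(* Since [V c_s U] is the rotated [c_s], the [B]'s are rotated alike and conjugated back. On [U psi]
   the inner [V U] cancels, and so it does behind the new bra [psi^* V], which leaves the old
   properties. *)
exists (fun s => U * rot B s * V) => s sn; split.
- rewrite !opM -[V *m (U *m psi)]opM VU mul1mx.
  rewrite -[LHS]mul1mx -[1%:M]/(1 : op R n) -UV opM; congr (_ *m _).
  rewrite -!opM rotation_conj //.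
  rewrite -[LHS]/(mulmxr psi _) -[RHS]/(mulmxr psi _) !rotate_linear.
  by apply: (eq_rotate _ _ pn qn) sn => t /hB[].
- have VU1 : V *m U = 1%:M := VU.
  have -> : U * rot B s * V = U *m (rot B s *m V) by rewrite mulmxA.
  rewrite adjmxM adjU -[LHS]mulmxA (mulmxA V) VU1 mul1mx mulmxA.
  suff -> : adjmx psi *m rot B s = 0 by rewrite mul0mx.
  rewrite -[LHS]/(mulmx (adjmx psi) _) !rotate_linear.
  rewrite (eq_rotate _ _ pn qn (g := fun=> 0)) //; last by move=> t /hB[].
  by rewrite /rotate !scaler0 subrr addr0; do 2?case: ifP.
- move=> m mn.
  have -> : c m * (U * rot B s * V) + U * rot B s * V * c m =
      U * (V * c m * U * rot B s + rot B s * (V * c m * U)) * V.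
    by rewrite conj_anticomm.
  rewrite rotation_conj // acomm_rotl.
  have -> : rot (fun t => c t * rot B s + rot B s * c t) m = rot (fun t =>
      (rot (fun u => (t == u)%:R + 'i * ofreal (M t u) : (cplx R)^o) s)%:M) m.
    apply: (eq_rotate _ _ pn qn) mn => t tn; rewrite acomm_rotr -rot_scalar.
    by apply: (eq_rotate _ _ pn qn) sn => u /hB[_ _]; apply.
  rewrite rot_scalar /rot rotate_covariance //.
  rewrite -[LHS]/(U *m _%:M *m V) mul_mx_scalar -scalemxAl.
  by rewrite -[U *m V]/(U * V) UV scalemx1.
Qed.
End Rotation.

(** * Action of the gates on Gaussian states *)

(** As [P] is an involution, its exponential is [x - y c_p c_q] with [x = cos phi] and
    [y = e sin phi]; the double-angle formulas give the entries of the rotation. *)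
Lemma gaussian_gate (R : realType) n p q (e phi : R) (P : op R n)
    (psi : 'cV[cplx R]_(dim n)) M :
  (p < 2 * n)%N -> (q < 2 * n)%N -> p != q -> e ^+ 2 = 1 ->
  P = ('i * ofreal e) *: (majorana R n p * majorana R n q) ->
  gaussian psi M ->
  gaussian (expmx (('i * ofreal phi) *: P) *m psi)
    (rotate2 p q (cos (phi *+ 2)) (e * sin (phi *+ 2)) M).
Proof.
move=> pn qn pq e1 PE gM.
have ii : 'i * 'i = -1 :> cplx R by rewrite -expr2 sqrCi.
have PP : P * P = 1.
  rewrite PE -[LHS]/((_ *: _) *m (_ *: _)) -scalemxAl -scalemxAr scalerA.
  rewrite -[_ *m _]/(_ * _) majorana_pair_sqr //.
  rewrite mulrACA ii -ofrealM -expr2 e1 ofreal1 mulr1 scaleN1r opprK //.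
rewrite expmx_involution // PE scalerA mulrACA ii mulN1r scaleNr -ofrealM
  [sin phi * e]mulrC.
have xy1 : cos phi ^+ 2 + (e * sin phi) ^+ 2 = 1.
  by rewrite exprMn e1 mul1r cos2Dsin2.
have -> : cos (phi *+ 2) = cos phi ^+ 2 - (e * sin phi) ^+ 2.
  by rewrite exprMn e1 mul1r mulr2n cosD !expr2.
have -> : e * sin (phi *+ 2) = cos phi * (e * sin phi) *+ 2.
  by rewrite mulr2n sinD; ring.
exact: gaussian_rotation.
Qed.

Lemma prod_ord_single (K : comPzRingType) n (j : 'I_n) (F : 'I_n -> K) (z : K) :
  (forall k, F k = if k == j then z else 1) -> \prod_(k < n) F k = z.
Proof.
move=> FE; rewrite (bigD1 j) //= FE eqxx big1 ?mulr1 // => k /negPf kj.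
by rewrite FE kj.
Qed.

Lemma pauli_Z_majorana (R : realType) n (j : 'I_n) :
  pauli_at R PZ j =
    ('i * ofreal (- 1)) *: (majorana R n (2 * j) * majorana R n (2 * j).+1).
Proof.
have ii : 'i * 'i = -1 :> cplx R by rewrite -expr2 sqrCi.
have h0 : (2 * j)./2 = j by lia.
have h1 : (2 * j).+1./2 = j by lia.
have o0 : odd (2 * j) = false by lia.
have o1 : odd (2 * j).+1 by lia.
rewrite /majorana pstring_mul (@prod_ord_single _ _ j _ 'i); last first.
  move=> k; rewrite /majorana_string h0 h1 o0 o1 -val_eqE /=.
  by case: ltngtP.
rewrite scalerA mulrAC ii ofrealN mulrNN !mulr1 scale1r pauli_atE.
apply: eq_pstring => k; rewrite /majorana_string h0 h1 o0 o1 -val_eqE /=.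
by case: ltngtP.
Qed.

(** The string of qubit [j+1] carries a Z at qubit [j]. Since YZ = iX and XZ = -iY, a left Pauli X
    needs the odd index [2j+1] and a left Pauli Y the even index [2j]; these phases also give
    [gen_sign]. Testing the numerical code mirrors what the program does. *)
Definition gen_left (g : generator) (j : nat) : nat :=
  if (gen_code g <= 1)%N then (2 * j + 1)%N else (2 * j)%N.

Definition gen_right (g : generator) (j : nat) : nat :=
  if (gen_code g <= 1)%N then (2 * j + 2 + gen_code g)%N
  else (2 * j + gen_code g)%N.

Definition gen_sign (R : realType) (g : generator) : R :=
  if (gen_code g <= 1)%N then -1 else 1.

Lemma gen_mx_majorana (R : realType) n g (j : 'I_n.-1) :
  gen_mx R g j = ('i * ofreal (gen_sign R g)) *:
    (majorana R n (gen_left g j) * majorana R n (gen_right g j)).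
Proof.
have ii : 'i * 'i = -1 :> cplx R by rewrite -expr2 sqrCi.
pose b := (gen_code g <= 1)%N; pose b' := odd (gen_code g).
have hl : (gen_left g j)./2 = j by rewrite /gen_left; case: (g) => /=; lia.
have hr : (gen_right g j)./2 = j.+1 by rewrite /gen_right; case: (g) => /=; lia.
have ol : odd (gen_left g j) = b by rewrite /gen_left /b; case: (g) => /=; lia.
have or : odd (gen_right g j) = b' by rewrite /gen_right /b'; case: (g) => /=; lia.
rewrite /majorana pstring_mul.
rewrite (@prod_ord_single _ _ (pair_left j) _ (- ('i * ofreal (gen_sign R g))));
  last first.
  move=> k; rewrite /majorana_string hl hr ol or -val_eqE /= /gen_sign -/b ltnS.
  case: ltngtP => [kj|kj|kj].
  - by [].
  - by case: ltngtP kj.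
  - by case: (b); rewrite /= ?ofrealN ofreal1 ?mulrN mulr1 ?opprK.
have -> : ('i * ofreal (gen_sign R g)) *: (- ('i * ofreal (gen_sign R g)) *:
  pstring R (fun k : 'I_n => pauli_mul (majorana_string (gen_left g j) k)
                 (majorana_string (gen_right g j) k))) =
  pstring R (fun k : 'I_n => pauli_mul (majorana_string (gen_left g j) k)
                 (majorana_string (gen_right g j) k)).
  rewrite scalerA mulrN mulrACA ii mulN1r opprK -ofrealM /gen_sign.
  by case: (_ <= _)%N; rewrite ?mulrNN mulr1 ofreal1 scale1r.
rewrite /gen_mx !pauli_atE pstring_mul big1 ?scale1r; last first.
  move=> k _; case: eqVneq => [->|_]; last by case: eqP => // _; case: (gen_paulis g).2.
  case: eqVneq => [/(congr1 val) /= |_]; first lia.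
  by case: (gen_paulis g).1.
apply: eq_pstring => k; rewrite /majorana_string hl hr ol or -!val_eqE /= ltnS.
have [kj|kj|kj] := ltngtP k j.
- by have -> : (k == j.+1 :> nat) = false by lia.
- by case: eqVneq => // _; rewrite /b'; case: (g).
- have -> : (k == j.+1 :> nat) = false by lia.
  by rewrite /b; case: (g).
Qed.

(** The factor 1/2 in the gate undoes the doubling of the angle, and its sign cancels the one in
    [Z = -i c_{2j} c_{2j+1}]; what remains is a rotation by [theta] itself. *)
Lemma gaussian_gate_Z (R : realType) n (j : 'I_n) (theta : R) psi M :
  gaussian psi M ->
  gaussian (expmx ((- ('i / 2%:R) * ofreal theta) *: pauli_at R PZ j) *m psi)
    (rotate2 (2 * j) (2 * j).+1 (cos theta) (sin theta) M).
Proof.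
move=> gM; have jn := ltn_ord j.
have -> : - ('i / 2%:R) * ofreal theta = 'i * ofreal (- (theta / 2%:R)).
  by rewrite ofrealN ofrealM ofrealV ofreal_nat; ring.
have t2 : (- (theta / 2%:R)) *+ 2 = - theta.
  by rewrite mulr2n -opprD -splitr.
rewrite (_ : cos theta = cos ((- (theta / 2%:R)) *+ 2)); last by rewrite t2 cosN.
rewrite (_ : sin theta = -1 * sin ((- (theta / 2%:R)) *+ 2)); last first.
  by rewrite t2 sinN mulrNN mul1r.
apply: gaussian_gate gM; [lia | lia | lia | by rewrite sqrrN expr1n |].
exact: pauli_Z_majorana.
Qed.

Lemma gaussian_gate_gen (R : realType) n g (j : 'I_n.-1) (theta : R) psi M :
  gaussian psi M ->
  gaussian (expmx (('i * ofreal theta) *: gen_mx R g j) *m psi)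
    (rotate2 (gen_left g j) (gen_right g j) (cos (theta *+ 2))
       (gen_sign R g * sin (theta *+ 2)) M).
Proof.
move=> gM; have jn := ltn_ord j.
apply: gaussian_gate gM; last exact: gen_mx_majorana.
- by rewrite /gen_left; case: g => /=; lia.
- by rewrite /gen_right; case: g => /=; lia.
- by rewrite /gen_left /gen_right; case: g => /=; lia.
- by rewrite /gen_sign; case: ifP; rewrite ?sqrrN expr1n.
Qed.

(** * Basis states and Wick's formula *)

Lemma majorana_car (R : realType) n m l : (m < 2 * n)%N -> (l < 2 * n)%N ->
  majorana R n m * majorana R n l + majorana R n l * majorana R n m =
    ((m == l)%:R *+ 2)%:M.
Proof.
move=> mn ln; case: eqVneq => [->|ml].
  by rewrite majorana_sqr mulr2n raddfD.
by rewrite (majorana_anticomm R mn ln ml) addNr mul0rn raddf0.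
Qed.

Lemma adjmx_ket (R : realType) n (a : bits n) :
  adjmx (ket R a) *m ket R a = 1%:M.
Proof.
apply/matrixP => i j; rewrite !ord1 !mxE (bigD1 (enum_rank a)) //= !mxE eqxx.
rewrite rmorph1 mulr1 big1 ?addr0 // => k /negPf ka.
by rewrite !mxE ka mulr0.
Qed.

Lemma pauli_Z_ket (R : realType) n (a : bits n) (j : 'I_n) :
  pauli_at R PZ j *m ket R a = ofreal (1 - 2 * (a j)%:R) *: ket R a.
Proof.
apply/matrixP => r c; rewrite /ket -colE ord1 !mxE eqxx andbT enum_rankK.
have [->|ra] := eqVneq r (enum_rank a).
  rewrite enum_rankK (bigD1 j) //= eqxx eqxx big1 ?mulr1; last first.
    by move=> k /negPf kj; rewrite kj eqxx.
  case: (a j) => /=; last by rewrite mulr0 subr0 ofreal1.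
  by rewrite expr1 -ofreal1 -ofrealN; congr ofreal; ring.
rewrite mulr0.
suff [k /negPf rk] : exists k, (enum_val r : bits n) k != a k.
  by rewrite (bigD1 k) //= rk; case: ifP; rewrite mul0r.
apply/existsP; apply: contraNT ra; rewrite negb_exists => /forallP ra.
apply/eqP; apply: enum_val_inj; rewrite enum_rankK; apply/ffunP => k; apply/eqP.
by have := ra k; rewrite negbK.
Qed.

(* M_{2j,2j+1} = - M_{2j+1,2j} = <Z_j>, all other entries vanish. *)
Definition basis_covariance (R : realType) (A : nat -> nat) (y z : nat) : R :=
  if (z == y.+1) && ~~ odd y then 1 - 2 * (A y./2)%:R
  else if (y == z.+1) && ~~ odd z then 2 * (A z./2)%:R - 1 else 0.

Definition majorana_partner (s : nat) : nat := if odd s then s.-1 else s.+1.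

(** Applying [c_{2j}] to the eigenvalue equation of [Z_j = -i c_{2j} c_{2j+1}] cancels the square of
    [c_{2j}] and gives the odd case; the even case solves that equation for [c_{2j}], as the
    eigenvalue squares to 1. *)
Lemma majorana_ket (R : realType) n (a : bits n) (A : nat -> nat) s :
  (forall j : 'I_n, A j = a j :> nat) -> (s < 2 * n)%N ->
  majorana R n s *m ket R a =
    ('i * ofreal (basis_covariance R A (majorana_partner s) s)) *:
      (majorana R n (majorana_partner s) *m ket R a).
Proof.
move=> Aa sn; have ii : 'i * 'i = -1 :> cplx R by rewrite -expr2 sqrCi.
have jn : (s./2 < n)%N by lia.
pose j := Ordinal jn; pose z : R := 1 - 2 * (a j)%:R.
have zz : z * z = 1.
  rewrite /z; case: (a j); rewrite /= ?mulr0 ?subr0 ?mulr1 //.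
  by ring.
have odd_ket : majorana R n (2 * j).+1 *m ket R a =
    ('i * ofreal z) *: (majorana R n (2 * j) *m ket R a).
  have := pauli_Z_ket R a j; rewrite -/z pauli_Z_majorana.
  move/(congr1 (mulmx (majorana R n (2 * j)))).
  rewrite -scalemxAl -!scalemxAr mulmxA -[_ *m (_ * _)]/(_ * (_ * _)) mulrA.
  rewrite majorana_sqr mul1r.
  move: (_ *m _) (_ *m _) => X Y /(congr1 (fun v => 'i *: v)).
  rewrite !scalerA => <-.
  by rewrite mulrA ii -ofreal1 -!ofrealN -ofrealM mulrNN mulr1 ofreal1 scale1r.
have [so|so] := boolP (odd s).
  have sE : s = (2 * j).+1 by rewrite /=; lia.
  have pE : majorana_partner s = (2 * j)%N by rewrite /majorana_partner so; lia.
  rewrite pE sE odd_ket /basis_covariance eqxx.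
  have -> : odd (2 * j) = false by lia.
  have -> : (2 * j)./2 = j by lia.
  by rewrite Aa.
have sE : s = (2 * j)%N by rewrite /=; lia.
have pE : majorana_partner s = (2 * j).+1 by rewrite /majorana_partner (negPf so); lia.
rewrite pE sE odd_ket scalerA /basis_covariance.
have -> : (2 * j == (2 * j).+2)%N = false by lia.
have -> : odd (2 * j) = false by lia.
have -> : (2 * j)./2 = j by lia.
have Aj : A s./2 = a j := Aa j.
rewrite eqxx /= Aj (_ : 2 * (a j)%:R - 1 = - z); last by rewrite opprB.
by rewrite mulrACA ii -ofrealM mulN1r -ofrealN mulNr opprK zz scale1r.
Qed.

Lemma gaussian_ket (R : realType) n (a : bits n) (A : nat -> nat) :
  (forall j : 'I_n, A j = a j :> nat) -> gaussian (ket R a) (basis_covariance R A).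
Proof.
move=> Aa; split; first exact: adjmx_ket.
pose k s := 'i * ofreal (basis_covariance R A (majorana_partner s) s).
(* Both summands act alike on the ket, so half their sum acts as [c_s]. On the bra they cancel,
   because [k s] is purely imaginary and changes sign under the adjoint. *)
exists (fun s => 2%:R^-1 *: (majorana R n s + k s *: majorana R n (majorana_partner s))).
have h2 : 2%:R^-1 + 2%:R^-1 = 1 :> cplx R.
  by rewrite -mulr2n -[LHS]mulr_natr mulVf // pnatr_eq0.
move=> s sn; have kE := majorana_ket R Aa sn.
split.
- by rewrite -scalemxAl mulmxDl -scalemxAl -kE scalerDr -scalerDl h2 scale1r.
- rewrite -scalemxAr mulmxDr -scalemxAr.
  have := congr1 (@adjmx R _ _) kE.
  rewrite adjmxZ !adjmxM !majorana_adj => ->.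
  by rewrite -scalerDl rmorphM /= conjCi ofreal_conj mulNr addNr scale0r scaler0.
- move=> m mn; have pn : (majorana_partner s < 2 * n)%N.
    by rewrite /majorana_partner; case: ifP; lia.
  rewrite -[_ * _]/(_ *m _) -[X in _ + X]/(_ *m _) -scalemxAr -scalemxAl -scalerDr.
  rewrite mulmxDl mulmxDr -scalemxAr -scalemxAl addrACA -scalerDr.
  rewrite -[X in X + _ *: _]/(_ * _ + _ * _) -[X in _ + _ *: X]/(_ * _ + _ * _).
  rewrite !majorana_car // !scale_scalar_mx -raddfD scale_scalar_mx; congr (_%:M).
  have -> : 'i * ofreal (basis_covariance R A m s) = k s * (m == majorana_partner s)%:R.
    case: eqVneq => [->|mp]; first by rewrite mulr1.
    rewrite mulr0 /basis_covariance.
    have -> : (s == m.+1) && ~~ odd m = false.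
      by apply/negP => /andP[/eqP sm mo]; case/eqP: mp; rewrite /majorana_partner;
        case: ifP; lia.
    have -> : (m == s.+1) && ~~ odd s = false.
      by apply/negP => /andP[/eqP sm mo]; case/eqP: mp; rewrite /majorana_partner;
        case: ifP; lia.
    by rewrite ofreal0 mulr0.
  have half X : 2%:R^-1 * (X *+ 2) = X :> cplx R.
    by rewrite (mulr2n X) mulrDr -mulrDl h2 mul1r.
  by rewrite mulrnAr -mulrnDl half.
Qed.

(* Moves B to the front of a product; B annihilates the bra, so only the
   contractions survive. *)
Lemma anticomm_move_right (F : comPzRingType) d (a b c B : 'M[F]_d) (x y z : F) :
  a *m B + B *m a = x%:M -> b *m B + B *m b = y%:M -> c *m B + B *m c = z%:M ->
  a *m b *m c *m B =
    z *: (a *m b) - y *: (a *m c) + x *: (b *m c) - B *m (a *m b *m c).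
Proof.
have swap (f : 'M[F]_d) t (A : 'M[F]_d) : f *m B + B *m f = t%:M ->
    A *m f *m B = t *: A - A *m B *m f.
  by move=> /(canRL (addrK _)) fB; rewrite -mulmxA fB mulmxBr mul_mx_scalar mulmxA.
move=> /(canRL (addrK _)) ax hb hc; rewrite (swap c z) // (swap b y) // ax.
rewrite !mulmxBl mul_scalar_mx -!scalemxAl !mulmxA.
move: (a *m b) (a *m c) (b *m c) (B *m a *m b *m c) => P Q S T.
by apply/matrixP => i j; rewrite !mxE; ring.
Qed.

Lemma sandwich_linear (F : comPzRingType) d (u : 'rV[F]_d) (v : 'cV[F]_d)
    (P Q S T : 'M[F]_d) x y z :
  u *m (z *: P - y *: Q + x *: S - T) *m v =
    z *: (u *m P *m v) - y *: (u *m Q *m v) + x *: (u *m S *m v) - u *m T *m v.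
Proof.
by rewrite mulmxBr mulmxDr mulmxBr mulmxBl mulmxDl mulmxBl -!scalemxAr -!scalemxAl.

Qed.

Lemma scalar_combination (F : comPzRingType) d (P Q S : 'M[F]_d) a b c x y z :
  P = a%:M -> Q = b%:M -> S = c%:M ->
  z *: P - y *: Q + x *: S = (z * a - y * b + x * c)%:M.
Proof. by move=> -> -> ->; rewrite !scale_scalar_mx raddfD raddfB. Qed.

Section Wick.
Variables (R : realType) (n : nat) (psi : 'cV[cplx R]_(dim n)) (M : nat -> nat -> R).
Hypothesis gM : gaussian psi M.

Local Notation e A := (adjmx psi *m A *m psi).
Local Notation c := (majorana R n).
Local Notation k m s := ((m == s)%:R + 'i * ofreal (M m s)).

Lemma wick2 m s : (m < 2 * n)%N -> (s < 2 * n)%N -> e (c m *m c s) = (k m s)%:M.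
Proof.
case: gM => psi1 [B hB] mn /hB[cB B0 /(_ m mn) /(canRL (addrK _)) car].
rewrite mulmxA -mulmxA cB mulmxA -(mulmxA _ _ (B s)) -[_ *m B s]/(_ * _) car.
rewrite mulmxBr mulmxBl -[B s * _]/(B s *m _) (mulmxA _ (B s)) B0 !mul0mx subr0.
by rewrite mul_mx_scalar -scalemxAl psi1 scalemx1.
Qed.

(** Moving [B s] leftwards contracts [s] with [r], [l] and [m] in turn; the pair that remains is
    evaluated by [wick2]. *)
Lemma wick4 m l r s : (m < 2 * n)%N -> (l < 2 * n)%N -> (r < 2 * n)%N ->
  (s < 2 * n)%N ->
  e (c m *m c l *m c r *m c s) =
    (k r s * k m l - k l s * k m r + k m s * k l r)%:M.
Proof.
case: gM => psi1 [B hB] mn ln rn sn; have [cB B0 car] := hB s sn.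
rewrite mulmxA -mulmxA cB mulmxA -(mulmxA _ _ (B s)).
rewrite (anticomm_move_right (car m mn) (car l ln) (car r rn)).
rewrite sandwich_linear (mulmxA _ (B s)) B0 !mul0mx subr0.
exact: (scalar_combination _ _ _ (wick2 mn ln) (wick2 mn rn) (wick2 ln rn)).
Qed.
End Wick.

(** For [i < j] the four indices are distinct, so the deltas vanish; the prefactor [(-i)^2] and the
    [i^2] of the two contractions multiply to 1, which leaves the Pfaffian on the rows
    [2i, 2i+1, 2j, 2j+1]. *)
Lemma gaussian_ZZ (R : realType) n (psi : 'cV[cplx R]_(dim n)) M (i j : 'I_n) :
  gaussian psi M -> (i < j)%N ->
  adjmx psi *m (pauli_at R PZ i * pauli_at R PZ j) *m psi =
    (ofreal (M (2 * i)%N (2 * i).+1 * M (2 * j)%N (2 * j).+1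
     - M (2 * i)%N (2 * j)%N * M (2 * i).+1 (2 * j).+1
     + M (2 * i)%N (2 * j).+1 * M (2 * i).+1 (2 * j)%N))%:M.
Proof.
move=> gM ij; have ii : 'i * 'i = -1 :> cplx R by rewrite -expr2 sqrCi.
have ltin := ltn_ord i; have ltjn := ltn_ord j.
rewrite !pauli_Z_majorana -[_ * _]/((_ *: (_ *m _)) *m (_ *: (_ *m _))).
rewrite -scalemxAl -!scalemxAr -!scalemxAl scalerA.
rewrite [majorana R n (2 * i) *m _ *m (_ *m _)]mulmxA.
rewrite (wick4 gM); [|lia|lia|lia|lia].
have e1 : (2 * j == (2 * j).+1)%N = false by lia.
have e2 : (2 * i == (2 * i).+1)%N = false by lia.
have e3 : ((2 * i).+1 == (2 * j).+1)%N = false by lia.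
have e4 : (2 * i == 2 * j)%N = false by lia.
have e5 : (2 * i == (2 * j).+1)%N = false by lia.
have e6 : ((2 * i).+1 == 2 * j)%N = false by lia.
rewrite e1 e2 e3 e4 e5 e6 !add0r scale_scalar_mx; congr (_%:M).
have H : ('i : cplx R) ^+ 2 = -1 by rewrite sqrCi.
by rewrite !(ofrealD, ofrealN, ofrealM, ofreal1); ring: H.
Qed.

(** * A program logic with time bounds *)

Lemma load_store (T : Type) (d : T) m x i v y j :
  load d (store d m x i v) y j =
    if (y == x) && (j == i) then v else load d m y j.
Proof.
by rewrite /load /store nth_set_nth /=; case: eqVneq => // ->; rewrite nth_set_nth.
Qed.

Section MemoryInvariant.
Variables (T : Type) (d : T) (k p B : nat) (m0 : seq (seq T)).

(** [k * B] bounds the memory. The first [p] arrays are the input, kept read-only so that loop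
    bounds and gate data can be read at any time. *)
Definition mem_inv (m : seq (seq T)) : Prop :=
  [/\ (size m <= k)%N, forall x, (size (nth [::] m x) <= B)%N
    & forall x, (x < p)%N -> nth [::] m x = nth [::] m0 x].

Lemma mem_inv_store m x i v : mem_inv m -> (p <= x < k)%N -> (i < B)%N ->
  mem_inv (store d m x i v).
Proof.
move=> [mk mB mp] /andP[px xk] iB; split=> [|y|y yp].
- by rewrite size_set_nth geq_max xk mk.
- rewrite nth_set_nth /=; case: eqP => _ //.
  by rewrite size_set_nth geq_max iB mB.
- rewrite nth_set_nth /=; case: (eqVneq y x) => [yx|_]; last exact: mp.
  by move: yp; rewrite yx ltnNge px.
Qed.

Lemma mem_inv_size m : mem_inv m -> (size (flatten m) <= k * B)%N.
Proof.
move=> [mk mB _]; apply: leq_trans (leq_mul mk (leqnn B)).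
elim: m mB {mk} => //= s m IHm mB.
rewrite size_cat mulSn leq_add ?(mB 0%N) // IHm // => x.
exact: (mB x.+1).
Qed.
End MemoryInvariant.

(** * Frames and syntactic time bounds *)

Fixpoint imods (c : cmd) : seq nat :=
  match c with
  | IStore x _ _ => [:: x]
  | Seq c d | If _ c d => imods c ++ imods d
  | While _ c => imods c
  | _ => [::]
  end.

Fixpoint rmods (c : cmd) : seq nat :=
  match c with
  | RStore x _ _ => [:: x]
  | Seq c d | If _ c d => rmods c ++ rmods d
  | While _ c => rmods c
  | _ => [::]
  end.

Definition frame (R : realType) (c : cmd) (st st' : state R) : Prop :=
  (forall x, x \notin imods c -> nth [::] (imem st') x = nth [::] (imem st) x) /\
  (forall x, x \notin rmods c -> nth [::] (rmem st') x = nth [::] (rmem st) x).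

Lemma exec_frame (R : realType) w c (st : state R) t st' :
  exec w c st t st' -> frame c st st'.
Proof.
elim=> {c st t st'} //.
- move=> x e v st _; split=> y //=; rewrite inE => yx.
  by rewrite /store nth_set_nth /= (negPf yx).
- move=> x e v st; split=> y //=; rewrite inE => yx.
  by rewrite /store nth_set_nth /= (negPf yx).
- move=> c d st t st' t' st'' _ [h1 h2] _ [h3 h4].
  split=> y /=; rewrite mem_cat negb_or => /andP[y1 y2].
    by rewrite h3 // h1.
  by rewrite h4 // h2.
- move=> b c d st t st' _ _ [h1 h2].
  by split=> y /=; rewrite mem_cat negb_or => /andP[y1 y2]; [rewrite h1 | rewrite h2].
- move=> b c d st t st' _ _ [h1 h2].
  by split=> y /=; rewrite mem_cat negb_or => /andP[y1 y2]; [rewrite h1 | rewrite h2].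
- move=> b c st t st' t' st'' _ _ [h1 h2] _ [h3 h4].
  by split=> y /= yc; [rewrite h3 // h1 | rewrite h4 // h2].
Qed.

Lemma exec_widen (R : realType) w w' c (st : state R) t st' : (w <= w')%N ->
  exec w c st t st' -> exec w' c st t st'.
Proof.
move=> ww'; elim=> {c st t st'}; try by constructor.
- by move=> x e v st vw; constructor; apply: leq_trans ww'.
- by move=> *; econstructor; eauto.
- by move=> *; apply: ExecWhileTrue; eauto.
Qed.

(* Bounds the running time when every loop makes at most [L] iterations. *)
Fixpoint time_bound (L : nat) (c : cmd) : nat :=
  match c with
  | Skip => 1
  | IStore _ e v => (icost e + icost v).+1
  | RStore _ e v => (icost e + rcost v).+1
  | Seq c d => time_bound L c + time_bound L d
  | If b c d => (bcost b + (time_bound L c + time_bound L d)).+1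
  | While b c => L * (bcost b + time_bound L c).+1 + (bcost b).+1
  end.

Fixpoint loop_depth (c : cmd) : nat :=
  match c with
  | Seq c d | If _ c d => maxn (loop_depth c) (loop_depth d)
  | While _ c => (loop_depth c).+1
  | _ => 0
  end.

(** Each enclosing loop contributes one factor [L], and everything else depends on the program text
    only, so [K] is uniform in [L]. *)
Lemma time_bound_poly c :
  exists K, forall L, (0 < L)%N -> (time_bound L c <= K * L ^ loop_depth c)%N.
Proof.
have widen K K' D D' L : (0 < L)%N -> (K <= K')%N -> (D <= D')%N ->
    (K * L ^ D <= K' * L ^ D')%N.
  by move=> L0 KK DD; rewrite leq_mul // leq_pexp2l.
elim: c => [|x e v|x e v|c [K1 h1] d [K2 h2]|b c [K1 h1] d [K2 h2]|b c [K h]] /=.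
- by exists 1%N => L _; rewrite expn0.
- by exists (icost e + icost v).+1 => L _; rewrite expn0 muln1.
- by exists (icost e + rcost v).+1 => L _; rewrite expn0 muln1.
- exists (K1 + K2)%N => L L0; rewrite mulnDl leq_add //.
    by apply: leq_trans (h1 L L0) _; rewrite widen // leq_maxl.
  by apply: leq_trans (h2 L L0) _; rewrite widen // leq_maxr.
- exists (bcost b + 1 + (K1 + K2))%N => L L0.
  rewrite -addn1 addnAC mulnDl leq_add //.
    by rewrite leq_pmulr // expn_gt0 L0.
  rewrite mulnDl leq_add //.
    by apply: leq_trans (h1 L L0) _; rewrite widen // leq_maxl.
  by apply: leq_trans (h2 L L0) _; rewrite widen // leq_maxr.
- exists ((bcost b).+1 + (bcost b).+1 + K)%N => L L0.
  rewrite expnS; have LD : (0 < L ^ loop_depth c)%N by rewrite expn_gt0 L0.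
  have := h L L0; move: (time_bound L c) (L ^ loop_depth c)%N LD => T P P0 TP.
  have h3 : (L * T <= L * (K * P))%N by rewrite leq_mul2l TP orbT.
  have h4 : (L <= L * P)%N by rewrite leq_pmulr.
  have h5 : (0 < L * P)%N by rewrite muln_gt0 L0.
  have h6 : ((bcost b).+1 * L <= (bcost b).+1 * (L * P))%N by rewrite leq_mul2l h4 orbT.
  have h7 : ((bcost b).+1 <= (bcost b).+1 * (L * P))%N by rewrite leq_pmulr.
  rewrite !mulnDl -addSn mulnDr [(L * _.+1)%N]mulnC [(K * (L * P))%N]mulnCA.
  lia.
Qed.

Definition ivar (x : nat) : iexp := ILoad x (IConst 0).
Definition rvar (x : nat) : rexp := RLoad x (IConst 0).

(** The test [v + 1 <= e] encodes [v < e]. The bound [e] is evaluated anew in each round, which is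
    why [wp_for] asks for its value in every state satisfying the invariant. *)
Definition for_ (v : nat) (e : iexp) (body : cmd) : cmd :=
  Seq (IStore v (IConst 0) (IConst 0))
    (While (BIle (IAdd (ivar v) (IConst 1)) e)
       (Seq body (IStore v (IConst 0) (IAdd (ivar v) (IConst 1))))).

Section Logic.
Variables (R : realType) (ki kr ni nr B L : nat) (st0 : state R).

Definition state_inv (st : state R) : Prop :=
  mem_inv ki ni B (imem st0) (imem st) /\ mem_inv kr nr B (rmem st0) (rmem st).

(** Total correctness with the time bound built in: [L] caps the rounds of every loop. The same [B]
    bounds the stored indices, through [exec], and the array lengths, through [state_inv]. *)
Definition wp (c : cmd) (Q : state R -> Prop) (st : state R) : Prop :=
  exists t st', [/\ exec B c st t st', (t <= time_bound L c)%N,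
    state_inv st' & Q st'].

Lemma wp_skip (Q : state R -> Prop) st : state_inv st -> Q st -> wp Skip Q st.
Proof. by move=> ok q; exists 1%N, st; split=> //; constructor. Qed.

Lemma wp_istore x e v (Q : state R -> Prop) st :
  let st' := State (store 0%N (imem st) x (ieval st e) (ieval st v)) (rmem st) in
  state_inv st -> (ni <= x < ki)%N -> (ieval st e < B)%N -> (ieval st v < B)%N ->
  (state_inv st' -> Q st') -> wp (IStore x e v) Q st.
Proof.
move=> st' [oki okr] xk eB vB q; exists (icost e + icost v).+1, st'.
have ok' : state_inv st' by split=> //; exact: mem_inv_store.
by split=> //; [exact: ExecIStore | exact: q].
Qed.

Lemma wp_rstore x e v (Q : state R -> Prop) st :
  let st' := State (imem st) (store 0 (rmem st) x (ieval st e) (reval st v)) in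
  state_inv st -> (nr <= x < kr)%N -> (ieval st e < B)%N ->
  (state_inv st' -> Q st') -> wp (RStore x e v) Q st.
Proof.
move=> st' [oki okr] xk eB q; exists (icost e + rcost v).+1, st'.
have ok' : state_inv st' by split=> //; exact: mem_inv_store.
by split=> //; [exact: ExecRStore | exact: q].
Qed.

Lemma wp_seq c d (Q1 Q : state R -> Prop) st :
  wp c Q1 st ->
  (forall st1, state_inv st1 -> frame c st st1 -> Q1 st1 -> wp d Q st1) ->
  wp (Seq c d) Q st.
Proof.
move=> [t1 [st1 [x1 le1 ok1 q1]]] h.
have [t2 [st2 [x2 le2 ok2 q2]]] := h st1 ok1 (exec_frame x1) q1.
exists (t1 + t2)%N, st2; split=> //; last exact: leq_add.
exact: ExecSeq x1 x2.
Qed.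

Lemma wp_if b c d (Q : state R -> Prop) st :
  (beval st b -> wp c Q st) -> (~~ beval st b -> wp d Q st) -> wp (If b c d) Q st.
Proof.
move=> hc hd; have [bt|bf] := boolP (beval st b).
  have [t [st' [x le ok q]]] := hc bt.
  exists (bcost b + t).+1, st'; split=> //; first exact: ExecIfTrue.
  by rewrite /= ltnS leq_add2l (leq_trans le) ?leq_addr.
have [t [st' [x le ok q]]] := hd bf.
exists (bcost b + t).+1, st'; split=> //; first exact: ExecIfFalse.
by rewrite /= ltnS leq_add2l (leq_trans le) ?leq_addl.
Qed.

(* The invariant is a predicate of the real memory alone, so that it is stable
   under the updates of the loop counter. *)
Lemma wp_for v e body N (I : nat -> seq (seq R) -> Prop) (Q : state R -> Prop) st :
  state_inv st -> (ni <= v < ki)%N -> (N < B)%N -> (N <= L)%N ->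
  v \notin imods body ->
  (forall st1, state_inv st1 -> ieval st1 e = N) ->
  I 0%N (rmem st) ->
  (forall k st1, (k < N)%N -> state_inv st1 -> frame (for_ v e body) st st1 ->
     ieval st1 (ivar v) = k -> I k (rmem st1) ->
     wp body (fun st2 => I k.+1 (rmem st2)) st1) ->
  (forall st', state_inv st' -> frame (for_ v e body) st st' -> I N (rmem st') ->
     Q st') ->
  wp (for_ v e body) Q st.
Proof.
move=> ok vk NB NL vbody eN I0 Istep IQ; have B_gt0 : (0 < B)%N by lia.
set b := BIle (IAdd (ivar v) (IConst 1)) e.
set body' := Seq body (IStore v (IConst 0) (IAdd (ivar v) (IConst 1))).
(* Induction on the number [m] of remaining rounds; the extra [(bcost b).+1] pays for the final,
   failing test. *)
have loop m k st1 : (k + m = N)%N -> state_inv st1 ->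
    frame (for_ v e body) st st1 -> ieval st1 (ivar v) = k -> I k (rmem st1) ->
    exists t st', [/\ exec B (While b body') st1 t st',
      (t <= m * (bcost b + time_bound L body').+1 + (bcost b).+1)%N,
      state_inv st', frame (for_ v e body) st st' & I N (rmem st')].
  elim: m k st1 => [|m IHm] k st1 kN ok1 fr1 vE Ik.
    have kE : k = N by lia.
    exists (bcost b).+1, st1; split=> //; last by rewrite -kE.
    apply: ExecWhileFalse; rewrite -[beval _ _]/(ieval st1 (ivar v) + 1 <= _)%N.
    by rewrite vE (eN _ ok1) kE addn1 ltnn.
  have kN' : (k < N)%N by lia.
  have [t2 [st2 [x2 le2 ok2 Ik1]]] := Istep k st1 kN' ok1 fr1 vE Ik.
  have v2 : ieval st2 (ivar v) = k.
    by rewrite -vE /= /load (exec_frame x2).1.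
  have vB : (ieval st2 (IAdd (ivar v) (IConst 1)) < B)%N.
    by rewrite -[ieval _ _]/(ieval st2 (ivar v) + 1)%N v2; lia.
  pose st3 := State (store 0%N (imem st2) v 0 (k + 1)%N) (rmem st2).
  (* The cost 6 is 1 for the address, 4 for the incremented counter and 1 for the store. *)
  have x3 : exec B (IStore v (IConst 0) (IAdd (ivar v) (IConst 1))) st2 6 st3.
    by rewrite /st3 -v2; exact: ExecIStore.
  have ok3 : state_inv st3 by case: ok2 => ? ?; split=> //; exact: mem_inv_store.
  have x23 : exec B body' st1 (t2 + 6)%N st3 := ExecSeq x2 x3.
  have fr3 : frame (for_ v e body) st st3.
    have [f1 f2] := fr1; have [g1 g2] := exec_frame x23.
    split=> y; rewrite /= => yv.
      rewrite g1 ?f1 //; apply: contra yv => yv; rewrite inE yv orbT //.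
    by rewrite g2 ?f2 //; apply: contra yv.
  have v3 : ieval st3 (ivar v) = k.+1.
    by rewrite /st3 /= load_store !eqxx addn1.
  have [t' [st' [x' le' ok' fr' IN]]] := IHm k.+1 st3 ltac:(lia) ok3 fr3 v3 Ik1.
  exists (bcost b + (t2 + 6) + t').+1, st'; split=> //.
    apply: ExecWhileTrue x23 x'.
    rewrite -[beval _ _]/(ieval st1 (ivar v) + 1 <= _)%N.
    by rewrite vE (eN _ ok1) addn1.
  have -> : time_bound L body' = (time_bound L body + 6)%N by [].
  move: le'; have -> : time_bound L body' = (time_bound L body + 6)%N by [].
  by rewrite mulSn; lia.
pose st1 := State (store 0%N (imem st) v 0 0) (rmem st).
have x1 : exec B (IStore v (IConst 0) (IConst 0)) st 3 st1 by exact: ExecIStore.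
have ok1 : state_inv st1 by case: ok => ? ?; split=> //; exact: mem_inv_store.
have fr1 : frame (for_ v e body) st st1.
  have [g1 g2] := exec_frame x1; split=> y yv; last exact: g2.
  by apply: g1; apply: contra yv; rewrite /= !inE => ->.
have v1 : ieval st1 (ivar v) = 0%N by rewrite /= load_store !eqxx.
have [t [st' [x le ok' fr' IN]]] := loop N 0%N st1 (add0n N) ok1 fr1 v1 I0.
exists (3 + t)%N, st'; split=> //; [exact: ExecSeq x1 x | | exact: IQ].
rewrite -[time_bound _ _]/(3 + (L * (bcost b + time_bound L body').+1 + (bcost b).+1))%N.
by rewrite leq_add2l (leq_trans le) // leq_add2r leq_mul2r NL orbT.
Qed.
End Logic.

(** * The algorithm *)

(* Scratch arrays, one cell each unless stated.  Indices: 5 and 6 hold the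
   counters of the block and of the gate (of i and j in [energy_cmd]), 7 and 8 the
   rotation plane (p, q), 9 the counter of a rotation, 10 the qubit of the current
   gate.  Reals: 2 the result, 3 a temporary, 4 the matrix M in row-major order,
   5 and 6 the cosine and the sine of the rotation. *)
Definition iN : iexp := ILoad 0 (IConst 0).
Definition iD : iexp := IMul (IConst 2) iN.
Definition addr (y z : iexp) : iexp := IAdd (IMul y iD) z.

(** The temporary keeps the old entry at [u], which the second store overwrites and the third still
    needs. *)
Definition rot_step (u v : iexp) : cmd :=
  Seq (RStore 3 (IConst 0) (RLoad 4 u))
  (Seq (RStore 4 u (RSub (RMul (rvar 5) (rvar 3)) (RMul (rvar 6) (RLoad 4 v))))
       (RStore 4 v (RAdd (RMul (rvar 6) (rvar 3)) (RMul (rvar 5) (RLoad 4 v))))).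

(** The first loop mixes the columns [p] and [q], the second the rows, in the nesting order of
    [rotate2]. *)
Definition rot_cmd : cmd :=
  Seq (for_ 9 iD (rot_step (addr (ivar 9) (ivar 7)) (addr (ivar 9) (ivar 8))))
      (for_ 9 iD (rot_step (addr (ivar 7) (ivar 9)) (addr (ivar 8) (ivar 9)))).

Lemma ieval_imem (R : realType) (st st' : state R) e :
  imem st = imem st' -> ieval st e = ieval st' e.
Proof.
by move=> h; elim: e => //= [x e ->|e -> f ->|e -> f ->|e -> f ->] //; rewrite h.
Qed.

Lemma frame_ivar (R : realType) c (st st' : state R) x :
  frame c st st' -> x \notin imods c -> ieval st' (ivar x) = ieval st (ivar x).
Proof. by move=> [h _] xc; rewrite /= /load h. Qed.

Lemma frame_load (R : realType) c (st st' : state R) x i :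
  frame c st st' -> x \notin rmods c -> load 0 (rmem st') x i = load 0 (rmem st) x i.
Proof. by move=> [_ h] xc; rewrite /load h. Qed.

Lemma addr_eq (D y z p k : nat) : (z < D)%N -> (k < D)%N ->
  (y * D + z == p * D + k)%N = (y == p) && (z == k).
Proof.
move=> zD kD; apply/eqP/andP => [h|[/eqP -> /eqP ->] //].
have D0 : (0 < D)%N by apply: leq_ltn_trans zD.
have := congr1 (divn^~ D) h; have := congr1 (modn^~ D) h.
by rewrite /= !modnMDl !modn_small // !divnMDl // !divn_small // !addn0 => -> ->.
Qed.

Definition is_mat (R : realType) (n : nat) (m : seq (seq R)) (M : nat -> nat -> R) :=
  forall y z, (y < 2 * n)%N -> (z < 2 * n)%N ->
    load 0 m 4 (y * (2 * n) + z)%N = M y z.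

(** * Correctness of the commands *)

Section Program.
Variables (R : realType) (n B L : nat) (st0 : state R).
Hypothesis B_gt : (4 * n ^ 2 < B)%N.
Hypothesis L_ge : (2 * n <= L)%N.
Hypothesis st0_n : load 0%N (imem st0) 0 0 = n.

(** 11 and 7 count the index and the real arrays in use; 5 and 2 count those among them that hold
    the input. *)
Local Notation wp := (wp 11 7 5 2 B L st0).
Local Notation state_inv := (state_inv 11 7 5 2 B st0).

Let B_gt0 : (0 < B)%N. Proof. exact: leq_ltn_trans B_gt. Qed.

Let lt_B k : (k < 4 * n ^ 2)%N -> (k < B)%N.
Proof. by move=> kn; apply: ltn_trans B_gt. Qed.

Let addr_lt y z : (y < 2 * n)%N -> (z < 2 * n)%N -> (y * (2 * n) + z < B)%N.
Proof. by move=> yn zn; apply: lt_B; rewrite expnS expn1; nia. Qed.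

Let le_B k : (k <= 2 * n)%N -> (k < B)%N.
Proof. by move=> kn; apply: leq_ltn_trans B_gt; nia. Qed.

Lemma inv_iload st x i : state_inv st -> (x < 5)%N ->
  load 0%N (imem st) x i = load 0%N (imem st0) x i.
Proof. by move=> [[_ _ h] _] x5; rewrite /load h. Qed.

Lemma inv_rload st x i : state_inv st -> (x < 2)%N ->
  load 0 (rmem st) x i = load 0 (rmem st0) x i.
Proof. by move=> [_ [_ _ h]] x5; rewrite /load h. Qed.

Lemma inv_iN st : state_inv st -> ieval st iN = n.
Proof. by move=> ok; rewrite /= inv_iload. Qed.

Lemma inv_iD st : state_inv st -> ieval st iD = (2 * n)%N.
Proof. by move=> ok; rewrite -[LHS]/(2 * ieval st iN)%N inv_iN. Qed.

Lemma inv_addr st y z : state_inv st ->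
  ieval st (addr y z) = (ieval st y * (2 * n) + ieval st z)%N.
Proof. by move=> ok; rewrite -(inv_iD ok). Qed.

Lemma rot_step_spec st u v p q (c s : R) : state_inv st ->
  ieval st u = p -> ieval st v = q -> p != q -> (p < B)%N -> (q < B)%N ->
  reval st (rvar 5) = c -> reval st (rvar 6) = s ->
  wp (rot_step u v) (fun st' => forall i, load 0 (rmem st') 4 i =
    if i == p then c * load 0 (rmem st) 4 p - s * load 0 (rmem st) 4 q
    else if i == q then s * load 0 (rmem st) 4 p + c * load 0 (rmem st) 4 q
    else load 0 (rmem st) 4 i) st.
Proof.
move=> ok up vq pq pB qB c5 s6; have qp : q == p = false by rewrite eq_sym (negPf pq).
have ue (m : seq (seq R)) : ieval (State (imem st) m) u = p.
  by rewrite -up; exact: ieval_imem.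
have ve (m : seq (seq R)) : ieval (State (imem st) m) v = q.
  by rewrite -vq; exact: ieval_imem.
apply: (wp_seq (Q1 := fun st1 => st1 = State (imem st)
    (store 0 (rmem st) 3 0 (load 0 (rmem st) 4 p)))).
  by apply: wp_rstore => //=; rewrite up.
move=> st1 ok1 _ E; subst st1.
set m1 := store _ _ 3 _ _ in ok1 *.
have h1 : load 0 m1 5 0 = c by rewrite /m1 load_store.
have h2 : load 0 m1 6 0 = s by rewrite /m1 load_store.
have h3 : load 0 m1 3 0 = load 0 (rmem st) 4 p by rewrite /m1 load_store.
have h4 i : load 0 m1 4 i = load 0 (rmem st) 4 i by rewrite /m1 load_store.
clearbody m1.
apply: (wp_seq (Q1 := fun st1 => st1 = State (imem st)
    (store 0 m1 4 p (c * load 0 (rmem st) 4 p - s * load 0 (rmem st) 4 q)))).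
  apply: wp_rstore => //; first by rewrite ue.
  by rewrite /= ue ve h1 h2 h3 h4.
move=> st1 ok2 _ E; subst st1.
apply: wp_rstore => //; first by rewrite ve.
move=> _ i; rewrite /= ve !load_store /= h1 h2 h3 !h4 qp.
by case: (eqVneq i q) => [->|_] //; rewrite qp.
Qed.

Lemma rot_spec st p q (c s : R) M : state_inv st ->
  ieval st (ivar 7) = p -> ieval st (ivar 8) = q ->
  (p < 2 * n)%N -> (q < 2 * n)%N -> p != q ->
  reval st (rvar 5) = c -> reval st (rvar 6) = s -> is_mat n (rmem st) M ->
  wp rot_cmd (fun st' => is_mat n (rmem st') (rotate2 p q c s M)) st.
Proof.
move=> ok p7 q8 pn qn pq c5 s6 isM.
have vB k : (k < 2 * n)%N -> (k < B)%N by move=> kn; apply: le_B; exact: ltnW.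
pose M1 y z : R := rotate p q c s (M y : nat -> R^o) z.
apply: (wp_seq (Q1 := fun st' => is_mat n (rmem st') M1)).
  apply: (wp_for (N := (2 * n)%N) (I := fun k m => is_mat n m
    (fun y z => if (y < k)%N then M1 y z else M y z))) => //.
  - exact: le_B.
  - exact: inv_iD.
  - move=> k st1 kn ok1 fr k9 isk.
    have p71 : ieval st1 (ivar 7) = p by rewrite (frame_ivar fr).
    have q81 : ieval st1 (ivar 8) = q by rewrite (frame_ivar fr).
    have c51 : reval st1 (rvar 5) = c by rewrite /= (frame_load _ fr).
    have s61 : reval st1 (rvar 6) = s by rewrite /= (frame_load _ fr).
    have [t [st2 [x le ok2 h]]] := rot_step_spec ok1
      (inv_addr (ivar 9) (ivar 7) ok1) (inv_addr (ivar 9) (ivar 8) ok1)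
      ltac:(by rewrite k9 p71 q81 addr_eq // eqxx) ltac:(by rewrite k9 p71 addr_lt)
      ltac:(by rewrite k9 q81 addr_lt) c51 s61.
    exists t, st2; split=> // y z yn zn.
    rewrite h k9 p71 q81 !addr_eq // !isk // ltnS ltnn.
    have [yk|yk|->] := ltngtP y k => //=.
  - by move=> st' _ _ h y z yn zn; rewrite h ?yn.
move=> st1 ok1 fr isM1.
have {}p7 : ieval st1 (ivar 7) = p by rewrite (frame_ivar fr).
have {}q8 : ieval st1 (ivar 8) = q by rewrite (frame_ivar fr).
have {}c5 : reval st1 (rvar 5) = c by rewrite /= (frame_load _ fr).
have {}s6 : reval st1 (rvar 6) = s by rewrite /= (frame_load _ fr).
apply: (wp_for (N := (2 * n)%N) (I := fun k m => is_mat n m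
  (fun y z => if (z < k)%N then rotate2 p q c s M y z else M1 y z))) => //.
- exact: le_B.
- exact: inv_iD.
- move=> k st2 kn ok2 fr2 k9 isk.
  have p72 : ieval st2 (ivar 7) = p by rewrite (frame_ivar fr2).
  have q82 : ieval st2 (ivar 8) = q by rewrite (frame_ivar fr2).
  have c52 : reval st2 (rvar 5) = c by rewrite /= (frame_load _ fr2).
  have s62 : reval st2 (rvar 6) = s by rewrite /= (frame_load _ fr2).
  have [t [st3 [x le ok3 h]]] := rot_step_spec ok2
    (inv_addr (ivar 7) (ivar 9) ok2) (inv_addr (ivar 8) (ivar 9) ok2)
    ltac:(by rewrite k9 p72 q82 addr_eq // eqxx andbT) ltac:(by rewrite k9 p72 addr_lt)
    ltac:(by rewrite k9 q82 addr_lt) c52 s62.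
  exists t, st3; split=> // y z yn zn.
  rewrite h k9 p72 q82 !addr_eq // !isk // ltnS ltnn.
  have [zk|zk|->] := ltngtP z k; rewrite ?andbT ?andbF //.
- by move=> st' _ _ h y z yn zn; rewrite h ?zn.
Qed.

Lemma wp_iset x v d (Q : state R -> Prop) st val : state_inv st ->
  (5 <= x < 11)%N -> ieval st v = val -> (val < B)%N ->
  (forall st1, state_inv st1 -> rmem st1 = rmem st ->
     (forall y, y != x -> ieval st1 (ivar y) = ieval st (ivar y)) ->
     ieval st1 (ivar x) = val -> wp d Q st1) ->
  wp (Seq (IStore x (IConst 0) v) d) Q st.
Proof.
move=> ok xk vE vB h.
apply: (wp_seq (Q1 := fun st1 => st1 =
    State (store 0%N (imem st) x 0 val) (rmem st))).
  by apply: wp_istore => //=; rewrite vE.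
move=> st1 ok1 _ E; subst st1; apply: h => //= => [y yx|].
  by rewrite load_store (negPf yx).
by rewrite load_store !eqxx.
Qed.

Lemma wp_rset x v d (Q : state R -> Prop) st val : state_inv st ->
  (2 <= x < 7)%N -> reval st v = val ->
  (forall st1, state_inv st1 -> imem st1 = imem st ->
     (forall y i, y != x -> load 0 (rmem st1) y i = load 0 (rmem st) y i) ->
     reval st1 (rvar x) = val -> wp d Q st1) ->
  wp (Seq (RStore x (IConst 0) v) d) Q st.
Proof.
move=> ok xk vE h.
apply: (wp_seq (Q1 := fun st1 => st1 =
    State (imem st) (store 0 (rmem st) x 0 val))).
  by apply: wp_rstore => //=; rewrite vE.
move=> st1 ok1 _ E; subst st1; apply: h => //= => [y i yx|].
  by rewrite load_store (negPf yx).
by rewrite load_store !eqxx.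
Qed.

(** The qubit is [n - (j+1)] for counter [j]: the state after some rounds is then a suffix of the
    product [layer1] applied to the initial one. *)
Definition gate_Z : cmd :=
  let theta := RLoad 0 (IAdd (IMul (ivar 5) iN) (ivar 10)) in
  Seq (IStore 10 (IConst 0) (ISub iN (IAdd (ivar 6) (IConst 1))))
  (Seq (IStore 7 (IConst 0) (IMul (IConst 2) (ivar 10)))
  (Seq (IStore 8 (IConst 0) (IAdd (ivar 7) (IConst 1)))
  (Seq (RStore 5 (IConst 0) (RCos theta))
  (Seq (RStore 6 (IConst 0) (RSin theta)) rot_cmd)))).

Lemma gate_Z_spec st b j theta M : state_inv st ->
  ieval st (ivar 5) = b -> ieval st (ivar 6) = j -> (j < n)%N ->
  load 0 (rmem st0) 0 (b * n + (n - j.+1))%N = theta -> is_mat n (rmem st) M ->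
  wp gate_Z (fun st' => is_mat n (rmem st') (rotate2 (2 * (n - j.+1))
    (2 * (n - j.+1)).+1 (cos theta) (sin theta) M)) st.
Proof.
set k := (n - j.+1)%N => ok v5 v6 jn thE isM.
have kn : (k < n)%N by rewrite /k; lia.
apply: (wp_iset (val := k)) => //.
- by rewrite -[LHS]/(ieval st iN - (ieval st (ivar 6) + 1))%N inv_iN // v6 addn1.
- by apply: le_B; lia.
move=> st1 ok1 r1 f1 v10.
apply: (wp_iset (val := (2 * k)%N)) => //; first by rewrite -v10.
  by apply: le_B; lia.
move=> st2 ok2 r2 f2 v7.
apply: (wp_iset (val := (2 * k).+1)) => //.
- by rewrite -[LHS]/(ieval st2 (ivar 7) + 1)%N v7 addn1.
- by apply: le_B; lia.
move=> st3 ok3 r3 f3 v8.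
have idxE : ieval st3 (IAdd (IMul (ivar 5) iN) (ivar 10)) = (b * n + k)%N.
  rewrite -[LHS]/(ieval st3 (ivar 5) * ieval st3 iN + ieval st3 (ivar 10))%N inv_iN //.
  by rewrite !f3 // !f2 // v10 f1 // v5.
apply: (wp_rset (val := cos theta)) => //.
  by rewrite -thE -idxE -(inv_rload (x := 0) _ ok3).
move=> st4 ok4 i4 f4 v5'.
apply: (wp_rset (val := sin theta)) => //.
  by rewrite -thE -idxE -(inv_rload (x := 0) _ ok4) //= i4.
move=> st5 ok5 i5 f5 v6'.
have iE e : ieval st5 e = ieval st3 e by apply: ieval_imem; rewrite i5.
have v7' : ieval st5 (ivar 7) = (2 * k)%N by rewrite iE f3.
have v8' : ieval st5 (ivar 8) = (2 * k).+1 by rewrite iE.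
apply: rot_spec => //; try lia.
- by rewrite /= f5 // v5'.
- by move=> y z yn zn; rewrite f5 // f4 // r3 r2 r1 isM.
Qed.

Definition pair_index : iexp :=
  IAdd (IMul (ivar 5) (ISub iN (IConst 1))) (ivar 10).

Definition gate_pair : cmd :=
  let gen := ILoad 2 pair_index in
  let theta2 := RAdd (RLoad 1 pair_index) (RLoad 1 pair_index) in
  Seq (RStore 5 (IConst 0) (RCos theta2))
  (If (BIle gen (IConst 1))
    (Seq (RStore 6 (IConst 0) (ROpp (RSin theta2)))
    (Seq (IStore 7 (IConst 0) (IAdd (IMul (IConst 2) (ivar 10)) (IConst 1)))
    (Seq (IStore 8 (IConst 0)
            (IAdd (IAdd (IMul (IConst 2) (ivar 10)) (IConst 2)) gen)) rot_cmd)))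
    (Seq (RStore 6 (IConst 0) (RSin theta2))
    (Seq (IStore 7 (IConst 0) (IMul (IConst 2) (ivar 10)))
    (Seq (IStore 8 (IConst 0) (IAdd (IMul (IConst 2) (ivar 10)) gen)) rot_cmd)))).

(** Each of the two layers scans all pairs; a gate of the other layer is skipped, which matches a
    factor 1 in [layer2]. *)
Definition pair_step (third : bool) : cmd :=
  Seq (IStore 10 (IConst 0) (ISub iN (IAdd (ivar 6) (IConst 2))))
    (If (BIeq (ILoad 3 pair_index) (IConst third)) gate_pair Skip).

Lemma gate_pair_spec st b k g theta M : state_inv st ->
  ieval st (ivar 5) = b -> ieval st (ivar 10) = k -> (k.+1 < n)%N ->
  load 0%N (imem st0) 2 (b * n.-1 + k)%N = gen_code g ->
  load 0 (rmem st0) 1 (b * n.-1 + k)%N = theta -> is_mat n (rmem st) M ->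
  wp gate_pair (fun st' => is_mat n (rmem st') (rotate2 (gen_left g k)
    (gen_right g k) (cos (theta *+ 2)) (gen_sign R g * sin (theta *+ 2)) M)) st.
Proof.
move=> ok v5 v10 kn gE thE isM.
have idxE : ieval st pair_index = (b * n.-1 + k)%N.
  rewrite -[LHS]/(ieval st (ivar 5) * (ieval st iN - 1) + ieval st (ivar 10))%N inv_iN //.
  by rewrite v10 v5 subn1.
have g4 : (gen_code g < 4)%N by case: g {gE}.
apply: (wp_rset (val := cos (theta *+ 2))) => //.
  by rewrite mulr2n -thE -idxE -(inv_rload (x := 1) _ ok).
move=> st1 ok1 i1 f1 v5'.
have iE e : ieval st1 e = ieval st e by apply: ieval_imem.
have gE1 st' : state_inv st' -> ieval st' pair_index = ieval st pair_index ->
    ieval st' (ILoad 2 pair_index) = gen_code g.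
  by move=> ok' h; rewrite -gE -idxE -h -(inv_iload _ ok').
have bE : beval st1 (BIle (ILoad 2 pair_index) (IConst 1)) = (gen_code g <= 1)%N.
  by rewrite -(gE1 st1).
have thE1 : reval st1 (RSin (RAdd (RLoad 1 pair_index) (RLoad 1 pair_index))) =
    sin (theta *+ 2).
  by rewrite mulr2n -thE -idxE -iE -(inv_rload (x := 1) _ ok1).
apply: wp_if; rewrite bE => hg.
- have sE : gen_sign R g * sin (theta *+ 2) = - sin (theta *+ 2).
    by rewrite /gen_sign hg mulN1r.
  rewrite sE /gen_left /gen_right hg.
  apply: (wp_rset (val := - sin (theta *+ 2))) => //; first by rewrite -thE1.
  move=> st2 ok2 i2 f2 v6'.
  have iE2 e : ieval st2 e = ieval st e by rewrite -iE; apply: ieval_imem.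
  apply: (wp_iset (val := (2 * k + 1)%N)) => //; first by rewrite -v10 -iE2.
    by apply: le_B; lia.
  move=> st3 ok3 r3 f3 v7.
  have v10' : ieval st3 (ivar 10) = k by rewrite f3 // iE2.
  apply: (wp_iset (val := (2 * k + 2 + gen_code g)%N)) => //.
  + rewrite -(gE1 st3) //; first by rewrite -v10'.
    rewrite -[LHS]/(ieval st3 (ivar 5) * (ieval st3 iN - 1) + ieval st3 (ivar 10))%N.
    by rewrite inv_iN // idxE !f3 // !iE2 v5 v10 subn1.
  + by apply: le_B; lia.
  move=> st4 ok4 r4 f4 v8.
  have v7' := etrans (f4 7%N isT) v7.
  apply: rot_spec => //; try lia.
  + by rewrite /= r4 r3 f2.
  + by rewrite /= r4 r3.
  + by move=> y z yn zn; rewrite r4 r3 f2 // f1 // isM.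
- have sE : gen_sign R g * sin (theta *+ 2) = sin (theta *+ 2).
    by rewrite /gen_sign (negPf hg) mul1r.
  rewrite sE /gen_left /gen_right (negPf hg).
  apply: (wp_rset (val := sin (theta *+ 2))) => //.
  move=> st2 ok2 i2 f2 v6'.
  have iE2 e : ieval st2 e = ieval st e by rewrite -iE; apply: ieval_imem.
  apply: (wp_iset (val := (2 * k)%N)) => //; first by rewrite -v10 -iE2.
    by apply: le_B; lia.
  move=> st3 ok3 r3 f3 v7.
  have v10' : ieval st3 (ivar 10) = k by rewrite f3 // iE2.
  apply: (wp_iset (val := (2 * k + gen_code g)%N)) => //.
  + rewrite -(gE1 st3) //; first by rewrite -v10'.
    rewrite -[LHS]/(ieval st3 (ivar 5) * (ieval st3 iN - 1) + ieval st3 (ivar 10))%N.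
    by rewrite inv_iN // idxE !f3 // !iE2 v5 v10 subn1.
  + by apply: le_B; lia.
  move=> st4 ok4 r4 f4 v8.
  have v7' := etrans (f4 7%N isT) v7.
  apply: rot_spec => //; try lia.
  + by rewrite /= r4 r3 f2.
  + by rewrite /= r4 r3.
  + by move=> y z yn zn; rewrite r4 r3 f2 // f1 // isM.
Qed.

Lemma pair_step_spec st third b j g d theta M : state_inv st ->
  ieval st (ivar 5) = b -> ieval st (ivar 6) = j -> (j < n.-1)%N ->
  let k := (n.-1 - j.+1)%N in
  load 0%N (imem st0) 2 (b * n.-1 + k)%N = gen_code g ->
  load 0%N (imem st0) 3 (b * n.-1 + k)%N = nat_of_bool d ->
  load 0 (rmem st0) 1 (b * n.-1 + k)%N = theta -> is_mat n (rmem st) M ->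
  wp (pair_step third) (fun st' => is_mat n (rmem st')
    (if d == third then rotate2 (gen_left g k) (gen_right g k) (cos (theta *+ 2))
       (gen_sign R g * sin (theta *+ 2)) M else M)) st.
Proof.
move=> ok v5 v6 jn k gE dE thE isM.
have kn : (k.+1 < n)%N by rewrite /k; lia.
apply: (wp_iset (val := k)) => //.
- rewrite -[LHS]/(ieval st iN - (ieval st (ivar 6) + 2))%N inv_iN // v6 /k; lia.
- by apply: le_B; lia.
move=> st1 ok1 r1 f1 v10.
have v5' : ieval st1 (ivar 5) = b by rewrite f1.
have bE : beval st1 (BIeq (ILoad 3 pair_index) (IConst third)) = (d == third).
  have idxE : ieval st1 pair_index = (b * n.-1 + k)%N.
    rewrite -[LHS]/(ieval st1 (ivar 5) * (ieval st1 iN - 1) + ieval st1 (ivar 10))%N.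
    by rewrite inv_iN // v10 v5' subn1.
  rewrite -[LHS]/(load 0%N (imem st1) 3 (ieval st1 pair_index) == third).
  by rewrite inv_iload // idxE dE; case: d {dE}; case: third.
apply: wp_if; rewrite bE => h.
  by rewrite h; apply: (gate_pair_spec (b := b)) => //; rewrite r1.
by rewrite (negPf h); apply: wp_skip => //; rewrite r1.
Qed.

(** Hiding the covariance matrix lets gates, layers and blocks compose through the state vector
    alone. *)
Definition tracks (psi : 'cV[cplx R]_(#|{: bits n}|)) (m : seq (seq R)) : Prop :=
  exists2 M, is_mat n m M & gaussian psi M.

(* The factors of the product act from the last one to the first one, so the
   loop runs through the gates of a layer backwards. *)
Lemma layer_spec m e body (F : 'I_m -> 'M[cplx R]_(#|{: bits n}|)) psi st :
  state_inv st -> (m <= 2 * n)%N -> 6%N \notin imods body ->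
  (forall st1, state_inv st1 -> ieval st1 e = m) -> tracks psi (rmem st) ->
  (forall (i : 'I_m) st1 phi, state_inv st1 -> frame (for_ 6 e body) st st1 ->
     ieval st1 (ivar 6) = (m - i.+1)%N -> tracks phi (rmem st1) ->
     wp body (fun st2 => tracks (F i *m phi) (rmem st2)) st1) ->
  wp (for_ 6 e body) (fun st' => tracks ((\prod_(i < m) F i) *m psi) (rmem st')) st.
Proof.
move=> ok mn b6 eE tr step.
have prodE : \prod_(i < m) F i = \prod_(i <- enum 'I_m) F i.
  by rewrite [index_enum _]unlock enumT.
apply: (wp_for (N := m) (I := fun k r =>
  tracks ((\prod_(i <- drop (m - k) (enum 'I_m)) F i) *m psi) r)).
- exact: ok.
- by [].
- exact: le_B.
- exact: leq_trans L_ge.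
- exact: b6.
- exact: eE.
- by rewrite subn0 drop_oversize ?size_enum_ord // big_nil mul1mx.
- move=> k st1 km ok1 fr k6 tr1.
  have im : (m - k.+1 < m)%N by lia.
  pose i := Ordinal im.
  have -> : drop (m - k.+1) (enum 'I_m) = i :: drop (m - k) (enum 'I_m).
    rewrite (drop_nth i) ?size_enum_ord // subnSK //; congr (_ :: _).
    by apply: val_inj; rewrite /= nth_enum_ord.
  rewrite big_cons -[X in tracks X]mulmxA.
  by apply: step tr1 => //; rewrite k6 /=; lia.
- by move=> st' _ _; rewrite subnn drop0 -prodE.
Qed.

Definition block_data (b : nat) (blk : block R n) : Prop :=
  [/\ forall j : 'I_n, load 0 (rmem st0) 0 (b * n + j)%N = blk_ztheta blk j,
      forall j : 'I_n.-1, load 0 (rmem st0) 1 (b * n.-1 + j)%N = blk_theta blk j,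
      forall j : 'I_n.-1,
        load 0%N (imem st0) 2 (b * n.-1 + j)%N = gen_code (blk_gen blk j)
    & forall j : 'I_n.-1,
        load 0%N (imem st0) 3 (b * n.-1 + j)%N = nat_of_bool (blk_third blk j)].

Lemma layer1_spec st b blk psi : state_inv st -> ieval st (ivar 5) = b ->
  block_data b blk -> tracks psi (rmem st) ->
  wp (for_ 6 iN gate_Z) (fun st' => tracks (layer1 blk *m psi) (rmem st')) st.
Proof.
move=> ok v5 [hz _ _ _] tr; apply: layer_spec => //.
- by lia.
- exact: inv_iN.
move=> i st1 phi ok1 fr v6 [M isM gM]; have ltin := ltn_ord i.
have iE : (n - (n - i.+1).+1)%N = i by lia.
have v5' : ieval st1 (ivar 5) = b by rewrite (frame_ivar fr).
have jn : (n - i.+1 < n)%N by lia.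
have thE : load 0 (rmem st0) 0 (b * n + (n - (n - i.+1).+1))%N = blk_ztheta blk i.
  by rewrite iE hz.
have [t [st2 [x le ok2 h]]] := gate_Z_spec ok1 v5' v6 jn thE isM.
exists t, st2; split; [exact: x | exact: le | exact: ok2 | rewrite iE in h].
by eexists; [exact: h | exact: gaussian_gate_Z].
Qed.

Definition iN1 : iexp := ISub iN (IConst 1).

Lemma layer2_spec st third b blk psi : state_inv st -> ieval st (ivar 5) = b ->
  block_data b blk -> tracks psi (rmem st) ->
  wp (for_ 6 iN1 (pair_step third))
    (fun st' => tracks (layer2 blk third *m psi) (rmem st')) st.
Proof.
move=> ok v5 [_ hth hg hd] tr; rewrite /layer2 big_mkcond.
apply: layer_spec => //.
- by lia.
- by move=> st1 ok1; rewrite -[LHS]/(ieval st1 iN - 1)%N inv_iN // subn1.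
move=> i st1 phi ok1 fr v6 [M isM gM]; have ltin := ltn_ord i.
have iE : (n.-1 - (n.-1 - i.+1).+1)%N = i by lia.
have v5' : ieval st1 (ivar 5) = b by rewrite (frame_ivar fr).
have jn : (n.-1 - i.+1 < n.-1)%N by lia.
have := @pair_step_spec st1 third b (n.-1 - i.+1) (blk_gen blk i) (blk_third blk i)
  (blk_theta blk i) M ok1 v5' v6 jn.
rewrite /= iE => /(_ (hg i) (hd i) (hth i) isM) [t [st2 [x le ok2 h]]].
exists t, st2; split; [exact: x | exact: le | exact: ok2 |].
case: ifP h => _ h; last by exists M; rewrite ?mul1mx.
by eexists; [exact: h | exact: gaussian_gate_gen].
Qed.

Definition block_step : cmd :=
  Seq (for_ 6 iN gate_Z)
    (Seq (for_ 6 iN1 (pair_step false)) (for_ 6 iN1 (pair_step true))).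

Lemma block_step_spec st b blk psi : state_inv st -> ieval st (ivar 5) = b ->
  block_data b blk -> tracks psi (rmem st) ->
  wp block_step (fun st' => tracks (block_mx_of blk *m psi) (rmem st')) st.
Proof.
move=> ok v5 data tr.
apply: (wp_seq (layer1_spec ok v5 data tr)) => st1 ok1 fr1 tr1.
have v5' : ieval st1 (ivar 5) = b by rewrite (frame_ivar fr1).
apply: (wp_seq (layer2_spec false ok1 v5' data tr1)) => st2 ok2 fr2 tr2.
have v5'' : ieval st2 (ivar 5) = b by rewrite (frame_ivar fr2).
have [t [st3 [x le ok3 tr3]]] := layer2_spec true ok2 v5'' data tr2.
exists t, st3; split; [exact: x | exact: le | exact: ok3 |].
by rewrite -[X in tracks X]mulmxA -[X in tracks X]mulmxA.
Qed.

Definition iS : iexp := ILoad 0 (IConst 1).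

Lemma circuit_rcons (bs : seq (block R n)) b :
  circuit_mx (rcons bs b) = block_mx_of b * circuit_mx bs.
Proof. by elim: bs => [|b' bs IHbs] /=; rewrite ?mul1r ?mulr1 // IHbs mulrA. Qed.

Lemma circuit_spec st (bs : seq (block R n)) psi : state_inv st ->
  load 0%N (imem st0) 0 1 = size bs -> (size bs < B)%N -> (size bs <= L)%N ->
  (forall b0 b, (b < size bs)%N -> block_data b (nth b0 bs b)) ->
  tracks psi (rmem st) ->
  wp (for_ 5 iS block_step)
    (fun st' => tracks (circuit_mx bs *m psi) (rmem st')) st.
Proof.
move=> ok sE sB sL data tr.
apply: (wp_for (N := size bs) (I := fun k r =>
  tracks (circuit_mx (take k bs) *m psi) r)).
- exact: ok.
- by [].
- exact: sB.
- exact: sL.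
- by [].
- by move=> st1 ok1; rewrite /= inv_iload.
- by rewrite take0 mul1mx.
- move=> k st1 ks ok1 fr k5 tr1.
  (* A default value for [nth], taken from the list itself, which is nonempty as [k < size bs]. *)
  have b0 : block R n by case: (bs) ks => // b *; exact: b.
  rewrite (take_nth b0) // circuit_rcons -[X in tracks X]mulmxA.
  exact: block_step_spec (data b0 k ks) tr1.
- by move=> st' _ _; rewrite take_size.
Qed.

(** * Preparation of the covariance matrix and evaluation of the energy *)

(** Only the two entries coupling the Majorana operators of one qubit are written; the other entries
    rely on fresh cells reading as 0. *)
Definition init_cmd : cmd :=
  let i0 := IMul (IConst 2) (ivar 5) in
  let i1 := IAdd i0 (IConst 1) in
  let a2 := RMul (ROfIndex (IConst 2)) (ROfIndex (ILoad 4 (ivar 5))) in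
  for_ 5 iN
    (Seq (RStore 4 (addr i0 i1) (RSub (ROfIndex (IConst 1)) a2))
         (RStore 4 (addr i1 i0) (RSub a2 (ROfIndex (IConst 1))))).

Lemma init_spec st : state_inv st -> (forall i, load 0 (rmem st) 4 i = 0) ->
  wp init_cmd (fun st' => is_mat n (rmem st')
    (basis_covariance R (fun j => load 0%N (imem st0) 4 j))) st.
Proof.
set A := fun j => load 0%N (imem st0) 4 j; move=> ok st4.
apply: (wp_for (N := n) (I := fun k m => is_mat n m
  (fun y z => if (y./2 < k)%N then basis_covariance R A y z else 0))) => //.
- by apply: le_B; lia.
- by apply: leq_trans L_ge; lia.
- exact: inv_iN.
- move=> k st1 kn ok1 fr k5 isk.
  have e0 : ieval st1 (IMul (IConst 2) (ivar 5)) = (2 * k)%N by rewrite -k5.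
  have e1 : ieval st1 (IAdd (IMul (IConst 2) (ivar 5)) (IConst 1)) = (2 * k).+1.
    by rewrite -[LHS]/(ieval st1 (IMul (IConst 2) (ivar 5)) + 1)%N e0 addn1.
  have u0 st' : state_inv st' -> imem st' = imem st1 ->
      ieval st' (addr (IMul (IConst 2) (ivar 5))
        (IAdd (IMul (IConst 2) (ivar 5)) (IConst 1))) =
      (2 * k * (2 * n) + (2 * k).+1)%N.
    by move=> ok' iE; rewrite inv_addr // !(ieval_imem _ iE) e0 e1.
  have u1 st' : state_inv st' -> imem st' = imem st1 ->
      ieval st' (addr (IAdd (IMul (IConst 2) (ivar 5)) (IConst 1))
        (IMul (IConst 2) (ivar 5))) =
      ((2 * k).+1 * (2 * n) + 2 * k)%N.
    by move=> ok' iE; rewrite inv_addr // !(ieval_imem _ iE) e0 e1.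
  have aE st' : state_inv st' -> imem st' = imem st1 ->
      reval st' (ROfIndex (ILoad 4 (ivar 5))) = (A k)%:R.
    move=> ok' iE; congr (_%:R); rewrite -k5 -(ieval_imem _ iE) /A.
    by rewrite -(inv_iload _ ok').
  apply: (wp_seq (Q1 := fun st2 => imem st2 = imem st1 /\
      rmem st2 = store 0 (rmem st1) 4 (2 * k * (2 * n) + (2 * k).+1)%N
        (1 - 2 * (A k)%:R))).
    apply: wp_rstore => //; first by rewrite u0 // addr_lt //; lia.
    by move=> _; split=> //=; rewrite -(aE st1) // -(u0 st1).
  move=> st2 ok2 _ [i2 r2].
  apply: wp_rstore => //; first by rewrite u1 // addr_lt //; lia.
  move=> _ y z yn zn.
  rewrite -[rmem _]/(store 0 (rmem st2) 4 _ _) u1 // r2 !load_store !eqxx !andTb.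
  rewrite !addr_eq //; try lia.
  have -> : reval st2 (RSub (RMul (ROfIndex (IConst 2))
      (ROfIndex (ILoad 4 (ivar 5)))) (ROfIndex (IConst 1))) = 2 * (A k)%:R - 1.
    by rewrite -(aE st2).
  have k0 : (2 * k)./2 = k by lia.
  have k1 : (2 * k).+1./2 = k by lia.
  have ko : odd (2 * k) = false by lia.
  rewrite (isk y z) // /basis_covariance ltnS.
  have [/andP[/eqP -> /eqP ->]|h1] := ifPn.
    have -> : (2 * k == (2 * k).+2)%N = false by lia.
    by rewrite k0 k1 ko leqnn eqxx.
  have [/andP[/eqP -> /eqP ->]|h2] := ifPn.
    by rewrite k0 ko leqnn eqxx.
  (* In the two rows of qubit [k] only the entries just written are nonzero. *)
  have [yk|yk|yk] := ltngtP y./2 k => //.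
  have -> : (z == y.+1) && ~~ odd y = false by lia.
  by have -> : (y == z.+1) && ~~ odd z = false by lia.
- by move=> st' _ _ h y z yn zn; rewrite (h y z yn zn); have -> : (y./2 < n)%N by lia.
Qed.

Definition pfaffian (M : nat -> nat -> R) (i j : nat) : R :=
  M (2 * i)%N (2 * i).+1 * M (2 * j)%N (2 * j).+1
     - M (2 * i)%N (2 * j)%N * M (2 * i).+1 (2 * j).+1
     + M (2 * i)%N (2 * j).+1 * M (2 * i).+1 (2 * j)%N.

Definition energy_cmd : cmd :=
  let i0 := IMul (IConst 2) (ivar 5) in
  let i1 := IAdd i0 (IConst 1) in
  let j0 := IMul (IConst 2) (ivar 6) in
  let j1 := IAdd j0 (IConst 1) in
  let M y z := RLoad 4 (addr y z) in
  Seq (RStore 2 (IConst 0) (ROfIndex (IConst 0)))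
    (for_ 5 iN (for_ 6 iN
      (If (BAnd (BIle (IAdd (ivar 5) (IConst 1)) (ivar 6))
             (BIeq (ILoad 1 (IAdd (IMul (ivar 5) iN) (ivar 6))) (IConst 1)))
         (RStore 2 (IConst 0) (RAdd (rvar 2)
            (RAdd (RSub (RMul (M i0 i1) (M j0 j1)) (RMul (M i0 j0) (M i1 j1)))
                  (RMul (M i0 j1) (M i1 j0)))))
         Skip))).

Definition edge_energy (M : nat -> nat -> R) (i j : nat) : R :=
  if (i < j)%N && (load 0%N (imem st0) 1 (i * n + j) == 1)%N
  then pfaffian M i j else 0.

Lemma energy_spec st M : state_inv st -> is_mat n (rmem st) M ->
  wp energy_cmd (fun st' => load 0 (rmem st') 2 0 =
    \sum_(0 <= i < n) \sum_(0 <= j < n) edge_energy M i j) st.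
Proof.
move=> ok isM; have nB : (n < B)%N by apply: le_B; lia.
have nL : (n <= L)%N by apply: leq_trans L_ge; lia.
apply: (wp_rset (val := 0)) => //.
move=> st1 ok1 i1 f1 v2.
have {isM} isM : is_mat n (rmem st1) M by move=> y z yn zn; rewrite f1 // isM.
apply: (wp_for (N := n) (I := fun k m => is_mat n m M /\
   load 0 m 2 0 = \sum_(0 <= i < k) \sum_(0 <= j < n) edge_energy M i j)) => //.
- exact: inv_iN.
- by rewrite big_geq.
- move=> k st2 kn ok2 fr2 v5 [isM2 S2].
  apply: (wp_for (N := n) (I := fun l m => is_mat n m M /\
    load 0 m 2 0 = \sum_(0 <= i < k) \sum_(0 <= j < n) edge_energy M i j +
      \sum_(0 <= j < l) edge_energy M k j)) => //.
  + exact: inv_iN.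
  + by rewrite [X in _ + X]big_geq // addr0.
  + move=> l st3 ln ok3 fr3 v6 [isM3 S3].
    have v5' : ieval st3 (ivar 5) = k by rewrite (frame_ivar fr3).
    have bE : beval st3 (BAnd (BIle (IAdd (ivar 5) (IConst 1)) (ivar 6))
        (BIeq (ILoad 1 (IAdd (IMul (ivar 5) iN) (ivar 6))) (IConst 1))) =
        (k < l)%N && (load 0%N (imem st0) 1 (k * n + l) == 1)%N.
      rewrite -[LHS]/((ieval st3 (ivar 5) + 1 <= ieval st3 (ivar 6))%N &&
        (load 0%N (imem st3) 1 (ieval st3 (ivar 5) * ieval st3 iN +
           ieval st3 (ivar 6)) == 1)%N).
      by rewrite v5' v6 inv_iN // inv_iload // addn1.
    apply: wp_if; rewrite bE => hb; last first.
      apply: wp_skip => //; split=> //.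
      by rewrite S3 [in RHS]big_nat_recr //= /edge_energy (negPf hb) addr0.
    apply: wp_rstore => // _; split=> [y z yn zn|].
      by rewrite /= load_store /= isM3.
    have i0 : ieval st3 (IMul (IConst 2) (ivar 5)) = (2 * k)%N by rewrite -v5'.
    have i1' : ieval st3 (IAdd (IMul (IConst 2) (ivar 5)) (IConst 1)) = (2 * k).+1.
      by rewrite -[LHS]/(ieval st3 (IMul (IConst 2) (ivar 5)) + 1)%N i0 addn1.
    have j0 : ieval st3 (IMul (IConst 2) (ivar 6)) = (2 * l)%N by rewrite -v6.
    have j1 : ieval st3 (IAdd (IMul (IConst 2) (ivar 6)) (IConst 1)) = (2 * l).+1.
      by rewrite -[LHS]/(ieval st3 (IMul (IConst 2) (ivar 6)) + 1)%N j0 addn1.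
    have ME u v y z : ieval st3 u = y -> ieval st3 v = z -> (y < 2 * n)%N ->
        (z < 2 * n)%N -> reval st3 (RLoad 4 (addr u v)) = M y z.
      by move=> uy vz yn zn; rewrite -isM3 // -uy -vz -inv_addr.
    rewrite -[rmem _]/(store 0 (rmem st3) 2 0 _) load_store !eqxx andTb.
    set u := reval _ _.
    have -> : u = load 0 (rmem st3) 2 0 + pfaffian M k l.
      rewrite /pfaffian -(ME _ _ _ _ i0 i1') -?(ME _ _ _ _ j0 j1) -?(ME _ _ _ _ i0 j0)
        -?(ME _ _ _ _ i1' j1) -?(ME _ _ _ _ i0 j1) -?(ME _ _ _ _ i1' j0) //; lia.
    by rewrite S3 -addrA [in RHS]big_nat_recr //= /edge_energy hb.
  + by move=> st' _ _ [h1 h2]; split=> //; rewrite h2 big_nat_recr.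
- by move=> st' _ _ [].
Qed.

End Program.

(** * From the input layout to the final bounds *)

Lemma nth_allpairs_ord (T U : Type) m (f : T -> 'I_m -> U) d s x0 b (j : 'I_m) :
  (b < size s)%N ->
  nth d [seq f x i | x <- s, i <- enum 'I_m] (b * m + j)%N = f (nth x0 s b) j.
Proof.
elim: s b => [|x s IHs] [|b] //= bs; rewrite nth_cat size_map size_enum_ord.
  by rewrite mul0n add0n ltn_ord (nth_map j) ?size_enum_ord // nth_ord_enum.
by rewrite mulSn -addnA ltnNge leq_addr /= addKn IHs.
Qed.

Lemma expval_gaussian (R : realType) n (E : rel 'I_n) (U : 'M[cplx R]_(#|{: bits n}|))
    (a : bits n) M :
  gaussian (U *m ket R a) M ->
  expval (maxcut_ham R E) U a =
    ofreal (\sum_(i < n) \sum_(j < n | (i < j)%N && E i j) pfaffian M i j).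
Proof.
set psi := U *m ket R a => gM.
have -> : expval (maxcut_ham R E) U a =
    (adjmx psi *m maxcut_ham R E *m psi) 0 0.
  by rewrite /expval /psi adjmxM -!mulmxA.
rewrite mulmx_sumr mulmx_suml summxE ofreal_sum; apply: eq_bigr => i _.
rewrite mulmx_sumr mulmx_suml summxE ofreal_sum; apply: eq_bigr => j /andP[ij _].
by rewrite (gaussian_ZZ gM ij) mxE eqxx mulr1n.
Qed.

Definition simulation : cmd := Seq init_cmd (Seq (for_ 5 iS block_step) energy_cmd).

(** The bounds on [B] make every input array fit, [2 <= B] being for the one that holds [n] and the
    number of blocks; [4 * n ^ 2] is the size of [M]. *)
Lemma simulation_spec (R : realType) n (E : rel 'I_n) (bs : seq (block R n))
    (a : bits n) B L :
  (4 * n ^ 2 < B)%N -> (size bs * n < B)%N -> (2 <= B)%N -> (size bs < B)%N ->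
  (2 * n <= L)%N -> (size bs <= L)%N ->
  wp 11 7 5 2 B L (input E bs a) simulation (fun st =>
    ofreal (output st) = expval (maxcut_ham R E) (circuit_mx bs) a) (input E bs a).
Proof.
move=> B_gt B_bs B2 sB L_ge sL; set st0 := input E bs a.
have st0_n : load 0%N (imem st0) 0 0 = n by [].
have sizeB : (size bs * n.-1 < B)%N by nia.
have inv0 : state_inv 11 7 5 2 B st0 st0.
  split; split=> //.
    do 5?[case]; rewrite /= ?size_allpairs ?size_map -?enumT ?size_enum_ord //; try nia.
    by move=> k; rewrite nth_nil.
  do 2?[case]; rewrite /= ?size_allpairs ?size_map -?enumT ?size_enum_ord //; try nia.
  by move=> k; rewrite nth_nil.
have st04 i : load 0 (rmem st0) 4 i = 0 by rewrite /load /= nth_nil.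
apply: (wp_seq (init_spec B_gt L_ge st0_n inv0 st04)) => st1 ok1 _ isM1.
set A := fun j : nat => _ in isM1.
have Aa (j : 'I_n) : A j = a j.
  by rewrite /A /load /= (nth_map j) ?size_enum_ord // nth_ord_enum.
have tr1 : tracks (ket R a) (rmem st1).
  by exists (basis_covariance R A) => //; exact: gaussian_ket.
have data b0 b : (b < size bs)%N -> block_data st0 b (nth b0 bs b).
  by move=> bb; split=> j; exact: nth_allpairs_ord.
apply: (wp_seq (circuit_spec B_gt L_ge st0_n ok1 erefl sB sL data tr1)).
move=> st2 ok2 _ [M isM gM].
have [t [st3 [x le ok3 h]]] := energy_spec B_gt L_ge st0_n ok2 isM.
exists t, st3; split=> //; rewrite (expval_gaussian E gM) /output h; congr ofreal.
rewrite big_mkord; apply: eq_bigr => i _; rewrite big_mkord [RHS]big_mkcond.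
apply: eq_bigr => j _; rewrite /edge_energy.
have -> : load 0%N (imem st0) 1 (i * n + j) = E i j.
  rewrite /load /= (nth_allpairs_ord _ _ i) ?size_enum_ord //.
  by rewrite nth_ord_enum.
by case: (E i j).
Qed.

Local Close Scope ring_scope.

Theorem proposition3 (R : realType) :
  exists prog : cmd,
  forall c : nat, exists C : nat,
  forall (n : nat) (E : rel 'I_n) (bs : seq (block R n)) (a : bits n),
    (0 < n)%N -> symmetric E -> irreflexive E -> (size bs <= c * n)%N ->
    exists (t : nat) (st : state R),
      [/\ exec (C * n ^ 5) prog (input E bs a) t st,
          ofreal (output st) =
            expval (maxcut_ham R E) (circuit_mx bs) a,
          (t <= C * n ^ 5)%N
        & (memory st <= C * n ^ 5)%N].
Proof.
exists simulation => c; have [K] := time_bound_poly simulation.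
(* The three levels are the blocks, the gates of a layer and the entries touched by one rotation. *)
have -> : loop_depth simulation = 3%N by [].
move=> time_le.
(* The first summand pays for the time [K * L ^ 3], the second for the memory: 18 = 11 + 7 arrays of
   at most [B] cells. *)
exists (K * (c + 2) ^ 3 + 18 * (c + 5))%N => n E bs a n0 _ _ bsn.
(* In [B], the part [c] covers the gate data and 5 exceeds the 4 needed for [M], since the bound is
   strict. In [L], the part [c] covers the blocks and 2 the [2 * n] rounds of a rotation. *)
pose B := ((c + 5) * n ^ 2)%N; pose L := ((c + 2) * n)%N.
have n2 : (n <= n ^ 2)%N by rewrite -{1}[n]expn1 leq_pexp2l.
have n0' : (0 < n ^ 2)%N by rewrite expn_gt0 n0.
have bsn2 : (size bs * n <= c * n ^ 2)%N.
  by rewrite expnS expn1 mulnA leq_mul2r bsn orbT.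
have cn : (c * n <= c * n ^ 2)%N by rewrite leq_mul2l n2 orbT.
have BE : B = (c * n ^ 2 + 5 * n ^ 2)%N by rewrite -mulnDl.
have L0 : (0 < L)%N by rewrite muln_gt0 n0 addn_gt0 orbT.
have [t [st [x le [oki okr] out]]] : wp 11 7 5 2 B L (input E bs a) simulation
    (fun st => ofreal (output st) = expval (maxcut_ham R E) (circuit_mx bs) a)
    (input E bs a).
  by apply: simulation_spec; rewrite ?BE /L; lia.
have n25 : (n ^ 2 <= n ^ 5)%N by rewrite leq_pexp2l.
have n35 : (n ^ 3 <= n ^ 5)%N by rewrite leq_pexp2l.
have B5 : (18 * B <= 18 * (c + 5) * n ^ 5)%N by rewrite /B mulnA leq_mul2l n25 orbT.
exists t, st; split=> //.
- by apply: exec_widen x; rewrite mulnDl; lia.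
- have LE : (K * L ^ 3 <= K * (c + 2) ^ 3 * n ^ 5)%N.
    by rewrite /L expnMn mulnA leq_mul2l n35 orbT.
  by apply: leq_trans le _; apply: leq_trans (time_le L L0) _; rewrite mulnDl; lia.
- have hi := mem_inv_size oki; have hr := mem_inv_size okr.
  by rewrite /memory mulnDl; lia.
Qed.
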